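(* Let $k$ be a field, let $S=k[f_1,\ldots,f_m]$ be a finitely generated homogeneous subalgebra of a polynomial ring $R = k[x_1, \ldots, x_n]$ (i.e. $f_1,\ldots,f_m\in R$ are homogeneous polynomials), and let $<$ be a monomial order on $R$. Then all the dimensions of $S$ and of its initial algebra $\mathrm{in}_<(S)$ are the same, i.e. $$\dim_{\mathrm{gr}}(S)=\dim(S)=\operatorname{tr.deg}_k(S)=\operatorname{GKdim}_k(S)=d(S)$$ $$=\dim_{\mathrm{gr}}(\mathrm{in}_<(S))=\dim(\mathrm{in}_<(S))=\operatorname{tr.deg}_k(\mathrm{in}_<(S))=\operatorname{GKdim}_k(\mathrm{in}_<(S))=d(\mathrm{in}_<(S)).$$
   Context: All rings are commutative with identity, and $\mathbb{N}$ contains $0$. A monomial order $<$ on $R=k[x_1,\ldots,x_n]$ is a total order on the set of monomials such that $1<x_i$ for all $i$, and $u<v$ implies $uw<vw$ for all monomials $u,v,w$. For nonzero $g\in R$, $\mathrm{in}_<(g)$ is the initial monomial of $g$, i.e. the largest monomial with respect to $<$ occurring in $g$ with nonzero coefficient. The initial algebra of $S$ is the $k$-subalgebra $\mathrm{in}_<(S)=k[\mathrm{in}_<(g)\mid g\in S]$ of $R$ generated by the initial monomials of (nonzero) elements of $S$; it need not be finitely generated. Both $S$ and $\mathrm{in}_<(S)$ are $\mathbb{N}$-graded by the standard grading inherited from $R$, with $\deg(x_i)=1$. For an $\mathbb{N}$-graded domain $A=\bigoplus_{n\ge0}A_n$ with $A_0=k$ and $\dim_kA_n<\infty$ for all $n$: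 $\dim(A)$ is the Krull dimension; $\dim_{\mathrm{gr}}(A)$, the graded Krull dimension, is the supremum of the lengths $r$ of chains $\mathfrak{p}_0\subsetneq\cdots\subsetneq\mathfrak{p}_r$ of homogeneous prime ideals of $A$; $\operatorname{tr.deg}_k(A)$ is the transcendence degree over $k$ of the fraction field of $A$. For a finite-dimensional $k$-subspace $V\subseteq A$, let $V^n$ be the $k$-span of all products of $n$ elements of $V$ and $d_V(n)=\dim_k(k+V+\cdots+V^n)$; the Gelfand--Kirillov dimension is $\operatorname{GKdim}_k(A)=\sup_V\limsup_{n\to\infty}\frac{\log d_V(n)}{\log n}$, over all finite-dimensional $k$-subspaces $V$ of $A$. With the Poincaré series $P_A(t)=\sum_{n\ge0}(\dim_kA_n)t^n$, $d(A)=\min\{d\in\mathbb{N}\mid\lim_{t\to1-0}(1-t)^dP_A(t)<\infty\}$, where $t\to1-0$ is the limit from the left and the condition means that the limit exists and is finite. *)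

(* Defs.v *)
From HB Require Import structures.
From mathcomp Require Import all_boot all_order all_algebra.
(* The notations of [mpoly] clash with those of [all_analysis]: [mpoly n k] is
   k[x_1, ..., x_n], [multinom n] its type of monomials (exponent vectors) and
   [mpolyX k u] the monomial u as a polynomial. *)
From mathcomp Require Import -(notations) mpoly.
From mathcomp Require Import all_classical all_reals all_analysis.

Set Implicit Arguments.
Unset Strict Implicit.
Unset Printing Implicit Defensive.

Import Order.TTheory GRing.Theory Num.Theory.
Import numFieldNormedType.Exports.

Local Open Scope classical_set_scope.
Local Open Scope ring_scope.

Section Dimension.
Variables (k : fieldType) (V : lmodType k).

Definition has_dim (W : set V) (r : nat) : Prop :=
  exists b : 'I_r -> V,
    [/\ forall i, W (b i),
        forall w, W w -> exists c : 'I_r -> k, w = \sum_i c i *: b i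
      & forall c : 'I_r -> k, \sum_i c i *: b i = 0 -> forall i, c i = 0].

(* Junk value 0 when W is not a finite-dimensional subspace. *)
Definition vdim (W : set V) : nat := xget 0%N [set r | has_dim W r].

Definition fd_subspace (W : set V) : Prop :=
  GRing.submod_closed (mem W) /\ exists r, has_dim W r.

Definition kspan (X : set V) : set V :=
  [set v | exists (r : nat) (c : 'I_r -> k) (x : 'I_r -> V),
     (forall i, X (x i)) /\ v = \sum_i c i *: x i].

End Dimension.

Section KrullDimension.
Variables (R : realType) (A : comNzRingType).

Definition prime_ideal (P : set A) : Prop :=
  idealr_closed (mem P) /\ prime_idealr_closed (mem P).

(* [gr d] is the degree-d part of A. *)
Definition homogeneous_ideal (gr : nat -> set A) (P : set A) : Prop :=
  forall a, P a -> exists (r : nat) (b : 'I_r -> A) (d : 'I_r -> nat),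
    (forall i, P (b i) /\ gr (d i) (b i)) /\ a = \sum_i b i.

Definition prime_chain (Q : set A -> Prop) (r : nat) : Prop :=
  exists P : nat -> set A,
    (forall i, (i <= r)%N -> prime_ideal (P i) /\ Q (P i)) /\
    (forall i, (i < r)%N -> P i `<` P i.+1).

Definition krull_dim : \bar R :=
  ereal_sup [set r%:R%:E | r in prime_chain setT].

Definition gr_krull_dim (gr : nat -> set A) : \bar R :=
  ereal_sup [set r%:R%:E | r in prime_chain (homogeneous_ideal gr)].

End KrullDimension.

Section TranscendenceDegree.
Variables (R : realType) (k L : fieldType) (iota : {rmorphism k -> L}).

Definition alg_indep (r : nat) (x : 'I_r -> L) : Prop :=
  forall p : mpoly r k, mmap iota x p = 0 -> p = 0.

Definition field_trdeg : \bar R :=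
  ereal_sup [set r%:R%:E | r in [set r | exists x : 'I_r -> L, alg_indep x]].

End TranscendenceDegree.

Definition trdeg (R : realType) (k : fieldType) (A : idomainType)
    (iota : {rmorphism k -> A}) : \bar R :=
  field_trdeg R (@tofrac A \o iota).

Section GKDimension.
Variables (R : realType) (k : fieldType) (A : algType k).

Definition subspace_pow (V : set A) (i : nat) : set A :=
  kspan [set \prod_(j < i) v j | v in [set v : 'I_i -> A | forall j, V (v j)]].

Definition subspace_pow_sum (V : set A) (N : nat) : set A :=
  [set \sum_(i < N.+1) w i
    | w in [set w : 'I_N.+1 -> A | forall i : 'I_N.+1, subspace_pow V i (w i)]].

Definition GKdim : \bar R :=
  ereal_sup
    [set limn_esup
           (fun N => (ln (vdim (subspace_pow_sum V N))%:R / ln N%:R : R)%:E)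
      | V in @fd_subspace k A].

End GKDimension.

Section PoincareSeries.
Variables (R : realType) (k : fieldType) (V : lmodType k).
Variable gr : nat -> set V.

Definition poincare_series (t : R) : \bar R :=
  (\sum_(0 <= i <oo) ((vdim (gr i))%:R * t ^+ i)%:E)%E.

(* The infimum of a set of natural numbers is its minimum, or +oo if it is
   empty. *)
Definition poincare_dim : \bar R :=
  ereal_inf [set d%:R%:E | d in [set d : nat | exists l : R,
    (((1 - t) ^+ d)%:E * poincare_series t)%E @[t --> at_left 1] --> l%:E]].

End PoincareSeries.

Section Subalgebra.
Variables (k : fieldType) (n : nat).
Implicit Type G : set (mpoly n k).

(* The smallest k-subalgebra k[G] of k[x_1, ..., x_n] containing G. *)
Definition gen_subalg G : {pred mpoly n k} :=
  [pred p | `[< forall A : {pred mpoly n k},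
                  GRing.subalg_closed A -> G `<=` [set` A] -> p \in A >]].

Lemma gen_subalg_closed G : GRing.subalg_closed (gen_subalg G).
Proof.
split=> [|a u v /asboolP hu /asboolP hv|u v /asboolP hu /asboolP hv];
  apply/asboolP=> A hA GA; case: (hA) => h1 hl hm.
- exact: h1.
- by apply: hl; [exact: hu|exact: hv].
- by apply: hm; [exact: hu|exact: hv].
Qed.

HB.instance Definition _ G :=
  GRing.isSubalgClosed.Build k (mpoly n k) (gen_subalg G) (gen_subalg_closed G).

Record subalgebra G :=
  Subalgebra { subalgebra_val : mpoly n k; _ : subalgebra_val \in gen_subalg G }.

HB.instance Definition _ G := [isSub for @subalgebra_val G].
HB.instance Definition _ G := [Choice of subalgebra G by <:].
HB.instance Definition _ G :=
  [SubChoice_isSubComNzRing of subalgebra G by <:].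
HB.instance Definition _ G :=
  [SubZmodule_isSubLmodule of subalgebra G by <:].
HB.instance Definition _ G :=
  [SubNzRing_SubLmodule_isSubLalgebra of subalgebra G by <:].
HB.instance Definition _ G :=
  [SubLalgebra_isSubAlgebra of subalgebra G by <:].

Definition subalgebra_unit G : pred (subalgebra G) :=
  [pred x | `[< exists y, y * x = 1 >]].

Definition subalgebra_inv G (x : subalgebra G) : subalgebra G :=
  xget x [set y | y * x = 1].

Lemma subalgebra_mulVx G :
  {in @subalgebra_unit G, left_inverse 1 (@subalgebra_inv G) *%R}.
Proof. by move=> x /asboolP; exact: (@xgetPex _ x [set y | y * x = 1]). Qed.

Lemma subalgebra_unitPl G (x y : subalgebra G) :
  y * x = 1 -> subalgebra_unit x.
Proof. by move=> yx; apply/asboolP; exists y. Qed.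

Lemma subalgebra_invr_out G :
  {in [predC @subalgebra_unit G], @subalgebra_inv G =1 id}.
Proof.
move=> x /asboolP xN; rewrite /subalgebra_inv; case: xgetP => // y _ yx.
by case: xN; exists y.
Qed.

HB.instance Definition _ G :=
  GRing.ComNzRing_hasMulInverse.Build (subalgebra G)
    (@subalgebra_mulVx G) (@subalgebra_unitPl G) (@subalgebra_invr_out G).

Lemma subalgebra_mulf_eq0 G : GRing.integral_domain_axiom (subalgebra G).
Proof.
move=> x y /(congr1 val) xy0.
have /eqP : val x * val y = 0 by [].
by rewrite mulf_eq0 => /orP[] /eqP h; apply/orP; [left|right]; apply/eqP;
  exact: val_inj.
Qed.

HB.instance Definition _ G :=
  GRing.ComUnitRing_isIntegral.Build (subalgebra G) (@subalgebra_mulf_eq0 G).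

Definition subalgebra_scalar G : {rmorphism k -> subalgebra G} :=
  in_alg (subalgebra G).

Definition std_grading G (d : nat) : set (subalgebra G) :=
  [set a | val a \is ishomog1 d mdeg].

End Subalgebra.

Arguments subalgebra_scalar {k n} G.
Arguments std_grading {k n} G d _.

Section InitialAlgebra.
Variables (k : fieldType) (n : nat) (lt : rel (multinom n)).

Definition monomial_order : Prop :=
  [/\ irreflexive lt,
      transitive lt,
      forall u v, u != v -> lt u v || lt v u,
      forall i : 'I_n, lt mnm0 (mnm1 i)
    & forall u v w, lt u v -> lt (mnm_add u w) (mnm_add v w)].

Definition is_initial (g : mpoly n k) (u : multinom n) : Prop :=
  u \in msupp g /\ forall v, v \in msupp g -> v != u -> lt v u.

Definition initial_monomials (S : {pred mpoly n k}) : set (mpoly n k) :=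
  [set p | exists g u, [/\ g \in S, is_initial g u & p = mpolyX k u]].

End InitialAlgebra.

(* Main.v *)
(** Let D be the rank of the semigroup of initial exponents of a graded
    subalgebra A. Counting exponents, which is the same as counting dimensions
    in A, shows that dim A_0 + ... + dim A_N lies between two multiples of N^D;
    this gives tr.deg A = GKdim A = D. A chain of primes yields algebraically
    independent elements, so dim_gr A <= dim A <= tr.deg A.

    A chain of D + 1 homogeneous primes is given by the kernels on A of the
    toric maps x_i |-> y_0^(w_i) y_i (i in J), x_i |-> y_0^(w_i) (i not in J),
    where J grows and the weights w represent the lexicographic order in a given
    degree; it ends with the specialisation of y_0 to a constant and with the
    irrelevant ideal. A dimension count shows that the inclusions are strict.

    If A is generated by finitely many homogeneous elements, then by Dickson's
    lemma its Poincare series is a polynomial divided by a product of factors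
    1 - t^w. The growth of the dimensions makes the order of its pole at 1
    equal to D. As S and in(S) have the same Poincare series, they have the
    same D. *)

Require Import Defs.
From mathcomp Require Import all_boot all_order all_algebra all_field.
From mathcomp Require Import -(notations) mpoly.
From mathcomp Require Import all_classical all_reals all_analysis.
From mathcomp Require Import ring lra zify.

Set Implicit Arguments.
Unset Strict Implicit.
Unset Printing Implicit Defensive.

Import Order.TTheory GRing.Theory Num.Theory.
Import numFieldNormedType.Exports.

Local Open Scope classical_set_scope.
Local Open Scope ring_scope.

(** The algebra in(S) need not be Noetherian, so dimension theory of affine algebras does not apply
    to it. Everything up to the pole order is therefore proved for an arbitrary subalgebra generated
    by homogeneous polynomials; finite generation serves only to make the Poincare series of S
    rational, and in(S) inherits this by equality of Hilbert functions.

    The rank D is taken for one fixed order, by degree and then lexicographic, for both algebras.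
    The given order enters through in(S) and the Hilbert functions.

    In the toric maps, y_0 prevents cancellation: whichever variables are dropped, the image of a
    generator keeps the image of its initial monomial as initial monomial. Strictness is a count in
    one large degree of order N. A map with l variables besides y_0 can produce only O(N^(l+1))
    monomials there, while l + 3 suitable elements of A have at least N^(l+2) products with
    independent images under the next map. The last value of y_0 lies in a finite extension of k,
    since over a finite field a nonzero polynomial may vanish at every element of k. *)

(** * Linear algebra: dimensions and independent families *)

Section LinearAlgebra.
Variable k : fieldType.

Lemma lin_relation (T : finType) (q : nat) (a : T -> 'I_q -> k) :
  (q < #|T|)%N ->
  exists2 c : T -> k, (exists t, c t != 0)
    & forall i, \sum_t c t * a t i = 0.
Proof.
move=> qT; pose A := \matrix_(i < #|T|, j < q) a (enum_val i) j.
have : kermx A != 0.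
  rewrite kermx_eq0; apply: contraL qT => /eqP rA; rewrite -leqNgt -rA.
  exact: rank_leq_col.
case/rowV0Pn => r /sub_kermxP rA0 r0.
exists (fun t => r 0 (enum_rank t)).
  have [j rj] : exists j, r 0 j != 0.
    apply/existsP; apply: contraNT r0; rewrite negb_exists => /forallP r0.
    apply/eqP/rowP => j; rewrite mxE; apply/eqP.
    by have := r0 j; rewrite negbK.
  by exists (enum_val j); rewrite enum_valK.
move=> i; have /rowP /(_ i) := rA0; rewrite !mxE => r0i; apply: etrans r0i.
rewrite (reindex (fun j : 'I_#|T| => enum_val j)) /=; last first.
  by exists enum_rank => x _; rewrite (enum_valK, enum_rankK).
by apply: eq_bigr => j _; rewrite mxE enum_valK.
Qed.

Variable V : lmodType k.

Definition lin_indep (T : finType) (v : T -> V) : Prop :=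
  forall c : T -> k, \sum_t c t *: v t = 0 -> forall t, c t = 0.

Lemma lin_indep_le_span (T : finType) (v : T -> V) r (b : 'I_r -> V) :
  (forall t, exists c : 'I_r -> k, v t = \sum_i c i *: b i) ->
  lin_indep v -> (#|T| <= r)%N.
Proof.
move=> /choice [a va] vI; rewrite leqNgt; apply/negP => rT.
have [c [t ct] c0] := lin_relation a rT.
suff /vI /(_ t) ct0 : \sum_t c t *: v t = 0 by rewrite ct0 eqxx in ct.
under eq_bigr do rewrite va scaler_sumr.
rewrite exchange_big big1 //= => i _.
under eq_bigr do rewrite scalerA.
by rewrite -scaler_suml c0 scale0r.
Qed.

Lemma has_dim_unique (W : set V) r s : has_dim W r -> has_dim W s -> r = s.
Proof.
move=> [b [bW bS bI]] [c [cW cS cI]]; apply/eqP; rewrite eqn_leq.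
rewrite -{1}[r]card_ord -{2}[s]card_ord.
by apply/andP; split; [apply: (lin_indep_le_span (b := c)) bI => i; exact: cS
                     |apply: (lin_indep_le_span (b := b)) cI => i; exact: bS].
Qed.

Lemma has_dim_vdim (W : set V) r : has_dim W r -> vdim W = r.
Proof.
move=> Wr; rewrite /vdim; case: xgetP => [s _ Ws|/(_ r)//].
exact: has_dim_unique Ws Wr.
Qed.

Lemma vdim_le (W : set V) B :
  (forall r (v : 'I_r -> V), (forall t, W (v t)) -> lin_indep v -> (r <= B)%N) ->
  (vdim W <= B)%N.
Proof.
move=> WB; rewrite /vdim; case: xgetP => // r _ [b [bW _ bI]].
exact: WB bI.
Qed.

Definition lin_closed (W : set V) : Prop :=
  W 0 /\ forall (a : k) u v, W u -> W v -> W (a *: u + v).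

Lemma lin_closed_sum (W : set V) (T : Type) (s : seq T) (P : pred T)
    (c : T -> k) (v : T -> V) :
  lin_closed W -> (forall t, P t -> W (v t)) -> W (\sum_(t <- s | P t) c t *: v t).
Proof.
move=> [W0 WD] Wv; elim/big_rec: _ => // t x Pt Wx.
by apply: WD => //; exact: Wv.
Qed.

(** A longest independent family in [W] exists by the bound [B]; it spans [W], since adjoining any
    [w] creates a relation in which [w] must occur. *)
Lemma lin_closed_has_dim (W : set V) B : lin_closed W ->
  (forall r (v : 'I_r -> V), (forall t, W (v t)) -> lin_indep v -> (r <= B)%N) ->
  exists r, has_dim W r.
Proof.
move=> Wlin WB.
pose P r := `[< exists v : 'I_r -> V, (forall t, W (v t)) /\ lin_indep v >].
have exP : exists r, P r.
  exists 0%N; apply/asboolP; exists (fun=> 0); split=> [[]//|c _ []//].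
have leP r : P r -> (r <= B)%N by move=> /asboolP [v [Wv vI]]; exact: WB vI.
have [r /asboolP [v [Wv vI]] rmax] := ex_maxnP exP leP.
exists r, v; split=> // w Ww.
pose v' (i : 'I_r.+1) := if unlift ord_max i is Some j then v j else w.
have v'N : ~ lin_indep v'.
  move=> v'I; have /rmax : P r.+1; last by rewrite ltnn.
  apply/asboolP; exists v'; split=> // t; rewrite /v'.
  by case: unliftP => [j _|_] //; exact: Wv.
have [c] : exists c : 'I_r.+1 -> k,
    \sum_t c t *: v' t = 0 /\ exists t, c t != 0.
  apply: contrapT => N; apply: v'N => c c0 t; apply/eqP/negPn/negP => ct.
  by apply: N; exists c; split=> //; exists t.
rewrite (bigD1_ord ord_max) //= => -[].
under eq_bigr do rewrite /v' liftK.
rewrite {1}/v' unlift_none => c0 [t ct].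
have cm : c ord_max != 0.
  apply: contraNneq ct => cm; move: c0; rewrite cm scale0r add0r => /vI ci.
  by case: (unliftP ord_max t) => [j ->|->]; rewrite ?ci ?cm.
exists (fun i => - (c ord_max)^-1 * c (lift ord_max i)).
under eq_bigr do rewrite -scalerA.
rewrite -scaler_sumr scaleNr -scalerN; apply: (scalerI cm).
by rewrite scalerA divff // scale1r; apply/eqP; rewrite -addr_eq0; apply/eqP.
Qed.

Lemma has_dim_vdim_indep (W : set V) (T : finType) (v : T -> V) r :
  has_dim W r -> (forall t, W (v t)) -> lin_indep v -> (#|T| <= r)%N.
Proof.
by move=> [b [_ bS _]] Wv; apply: (@lin_indep_le_span _ _ _ b) => t; exact: bS.
Qed.

End LinearAlgebra.

(** * Monomial orders and homogeneous components *)

Section MonomialOrder.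
Variables (k : fieldType) (n : nat).
Implicit Types (p g : mpoly n k) (u v : multinom n).

(** Taking the coefficients at [E] is injective on [W], so more than [size E] elements satisfy a
    linear relation. *)
Lemma lin_indep_le_supp (T : finType) (x : T -> mpoly n k)
    (W : set (mpoly n k)) (E : seq (multinom n)) :
  lin_closed W -> (forall t, W (x t)) ->
  (forall w, W w -> w != 0 -> exists2 u, u \in E & u \in msupp w) ->
  lin_indep x -> (#|T| <= size E)%N.
Proof.
move=> Wlin Wx WE xI; rewrite leqNgt; apply/negP => ET.
have [c [t ct] c0] := lin_relation (fun t (i : 'I_(size E)) =>
  mcoeff (tnth (in_tuple E) i) (x t)) ET.
pose w := \sum_t c t *: x t.
have Ww : W w by apply: lin_closed_sum.
suff /xI /(_ t) ct0 : w = 0 by rewrite ct0 eqxx in ct.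
apply/eqP/negPn/negP => /(WE _ Ww) [u uE]; rewrite mcoeff_msupp => /negP; apply.
have uE' : (index u E < size E)%N by rewrite index_mem.
have /eqP/(etrans _) := c0 (Ordinal uE'); apply; congr (_ == _).
rewrite /w raddf_sum /=; apply: eq_bigr => i _.
by rewrite (tnth_nth u) /= nth_index // mcoeffZ.
Qed.

Variable lt : rel (multinom n).
Hypothesis hlt : monomial_order lt.

Lemma monomial_max (s : seq (multinom n)) : s != [::] ->
  exists2 u, u \in s & forall v, v \in s -> v != u -> lt v u.
Proof.
case: hlt => _ lt_trans lt_total _ _.
case: s => // a s _; elim: s a => [|b s IH] a.
  by exists a; rewrite ?inE // => v; rewrite inE => /eqP ->; rewrite eqxx.
have [u us umax] := IH b.
have [ua|] := boolP ((u == a) || lt a u).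
  exists u; first by rewrite inE us orbT.
  move=> v; rewrite inE => /orP[/eqP -> av|/umax//].
  by move: ua; rewrite eq_sym (negbTE av).
rewrite negb_or => /andP[/lt_total /orP[ua|->//] _].
exists a; first by rewrite inE eqxx.
move=> v; rewrite inE => /orP[/eqP ->|vs _]; first by rewrite eqxx.
have [->//|vu] := eqVneq v u.
exact: lt_trans (umax _ vs vu) ua.
Qed.

Lemma ex_initial p : p != 0 -> exists u, is_initial lt p u.
Proof.
by rewrite -msupp_eq0 => /monomial_max [u up umax]; exists u.
Qed.

(** Among the terms with nonzero coefficient, the largest initial exponent occurs in one element
    only and cannot cancel. *)
Lemma initial_lin_indep (T : finType) (x : T -> mpoly n k)
    (u : T -> multinom n) :
  injective u -> (forall t, is_initial lt (x t) (u t)) -> lin_indep x.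
Proof.
case: hlt => lt_irr lt_trans _ _ _.
move=> uI xu c c0 t; apply/eqP/negPn/negP => ct.
have [] := @monomial_max [seq u t | t <- enum T & c t != 0].
  have : u t \in [seq u t | t <- enum T & c t != 0].
    by rewrite mem_map // mem_filter ct mem_enum.
  by case: [seq _ | _ <- _ & _].
move=> _ /mapP [s + ->]; rewrite mem_filter => /andP[cs _] smax.
have [us _] := xu s.
have /eqP : mcoeff (u s) (\sum_t c t *: x t) = 0 by rewrite c0 mcoeff0.
rewrite raddf_sum (bigD1 s) //= big1 ?addr0.
  by rewrite mcoeffZ mulf_eq0 (negbTE cs) /= mcoeff_eq0 us.
move=> r rs; rewrite mcoeffZ.
have [->|cr] := eqVneq (c r) 0; first by rewrite mul0r.
have ltrs : lt (u r) (u s).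
  apply: smax; last by rewrite (inj_eq uI).
  by rewrite mem_map // mem_filter cr mem_enum.
rewrite memN_msupp_eq0 ?mulr0 //; apply/negP => usr.
have [_ rmax] := xu r.
have := rmax _ usr; rewrite (inj_eq uI) eq_sym => /(_ rs) ltsr.
by have := lt_trans _ _ _ ltsr ltrs; rewrite lt_irr.
Qed.

Lemma is_initialM p g u v : is_initial lt p u -> is_initial lt g v ->
  is_initial lt (p * g) (mnm_add u v).
Proof.
case: hlt => lt_irr lt_trans _ _ lt_add [up umax] [vg vmax].
have lt_addl a b c : lt a b -> lt (mnm_add c a) (mnm_add c b).
  by rewrite ![mnm_add c _]addmC; exact: lt_add.
have le_add a b : a \in msupp p -> b \in msupp g ->
    (a, b) != (u, v) -> lt (mnm_add a b) (mnm_add u v).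
  move=> ap bg; have [-> nab|au _] := eqVneq a u.
    by apply/lt_addl/vmax => //; apply: contra nab => /eqP ->.
  have lt_au : lt (mnm_add a b) (mnm_add u b) by apply/lt_add/umax.
  have [<-//|bv] := eqVneq b v.
  by apply: lt_trans lt_au _; apply/lt_addl/vmax.
split=> [|w]; last first.
  move=> /msuppM_le /allpairsP [[a b] /= [ap bg ->]] nab.
  by apply: le_add => //; apply: contraNneq nab => -[-> ->].
rewrite mcoeff_msupp mpolyME raddf_sum big_allpairs /=.
rewrite (big_rem u) //= (big_rem v) //= mcoeffZ mcoeffX eqxx mulr1.
rewrite big1_seq ?addr0.
  rewrite big1_seq ?addr0; first by rewrite mulf_neq0 // -mcoeff_msupp.
  move=> a /=; rewrite mem_rem_uniq ?msupp_uniq // inE => /andP[au ap].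
  rewrite big1_seq // => b bg; rewrite mcoeffZ mcoeffX.
  have /le_add H : (a, b) != (u, v) by apply: contra au => /eqP[->].
  have := H ap bg.
  by case: eqP => [->|]; rewrite ?lt_irr ?mulr0.
move=> b /=; rewrite mem_rem_uniq ?msupp_uniq // inE => /andP[bv bg].
rewrite mcoeffZ mcoeffX.
have /le_add H : (u, b) != (u, v) by apply: contra bv => /eqP[->].
have := H up bg.
by case: eqP => [->|]; rewrite ?lt_irr ?mulr0.
Qed.

End MonomialOrder.

(** This order compares degrees first and then exponents lexicographically; the toric maps below
    rely on both features. *)
Lemma mnmc_monomial_order n : monomial_order (fun u v : multinom n => (u < v)%O).
Proof.
split=> [u|u v w|u v uv|i|u v w].
- exact: ltxx.
- exact: lt_trans.
- by rewrite -neq_lt.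
- by rewrite lt_neqAle le0m andbT eq_sym mnm1_eq0.
- by rewrite ltmc_add2l.
Qed.

Section GeneratedSubalgebra.
Variables (k : fieldType) (n : nat) (G : set (mpoly n k)).

Lemma gen_subalg_min (A : {pred mpoly n k}) :
  GRing.subalg_closed A -> G `<=` [set` A] -> {subset gen_subalg G <= A}.
Proof. by move=> Acl GA p /asboolP; apply. Qed.

Lemma gen_subalg_gen g : G g -> g \in gen_subalg G.
Proof. by move=> Gg; apply/asboolP => A _; apply. Qed.

Hypothesis Ghom : forall g, G g -> exists d, g \is ishomog1 d mdeg.

(** The sums of homogeneous elements of the algebra are closed under its operations and include the
    generators. *)
Lemma gen_subalg_homog_sum p : p \in gen_subalg G ->
  exists2 s : seq (nat * mpoly n k),
    (forall x, x \in s -> x.2 \in gen_subalg G /\ x.2 \is ishomog1 x.1 mdeg)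
    & p = \sum_(x <- s) x.2.
Proof.
pose A := [pred p | `[< exists2 s : seq (nat * mpoly n k),
    (forall x, x \in s -> x.2 \in gen_subalg G /\ x.2 \is ishomog1 x.1 mdeg)
    & p = \sum_(x <- s) x.2 >]].
move=> pG; apply/asboolP; move: p pG; apply: (@gen_subalg_min A); last first.
  move=> g Gg; apply/asboolP; have [d gd] := Ghom Gg.
  exists [:: (d, g)]; last by rewrite big_seq1.
  by move=> x; rewrite inE => /eqP -> /=; split=> //; exact: gen_subalg_gen.
split=> [|a u v /asboolP [s sP ->] /asboolP [t tP ->]|
          u v /asboolP [s sP ->] /asboolP [t tP ->]]; apply/asboolP.
- exists [:: (0%N, 1)]; last by rewrite big_seq1.
  by move=> x; rewrite inE => /eqP -> /=; rewrite rpred1 dhomog1.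
- exists ([seq (x.1, a *: x.2) | x <- s] ++ t).
    move=> x; rewrite mem_cat => /orP[/mapP [y /sP [yG yh] ->]|/tP //] /=.
    by split; apply: rpredZ.
  by rewrite big_cat big_map scaler_sumr.
- exists [seq ((x.1 + y.1)%N, x.2 * y.2) | x <- s, y <- t].
    move=> x /allpairsP [[y z] /= [/sP [yG yh] /tP [zG zh] ->]] /=.
    by split; [apply: rpredM | apply: dhomogM].
  rewrite big_allpairs_dep mulr_suml; apply: eq_bigr => x _.
  by rewrite mulr_sumr.
Qed.

Lemma pihomog_gen_subalg d p :
  p \in gen_subalg G -> pihomog mdeg d p \in gen_subalg G.
Proof.
move=> /gen_subalg_homog_sum [s sP ->].
rewrite raddf_sum big_seq; apply: rpred_sum => x /sP [xG xh].
rewrite /=; have [<-|dx] := eqVneq x.1 d; first by rewrite pihomog_dE.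
by rewrite (pihomog_ne0 dx) // rpred0.
Qed.

End GeneratedSubalgebra.

(** * The rank of a set of exponents *)

Section MonomialRank.
Variable n : nat.
Implicit Types (v w : multinom n) (X : set (multinom n)).

Definition mnm_row v : 'rV[rat]_n := \row_j (v j)%:R.

Definition mnm_mx D (u : 'I_D -> multinom n) : 'M[rat]_(D, n) :=
  \matrix_(i, j) (u i j)%:R.

(** Thus [D] is the dimension of the rational span of [X]; the basis is taken from [X] itself so
    that it consists of exponents of actual elements. *)
Definition mnm_basis X D (u : 'I_D -> multinom n) : Prop :=
  [/\ forall i, X (u i), row_free (mnm_mx u)
    & forall v, X v -> (mnm_row v <= mnm_mx u)%MS].

Lemma ex_mnm_basis X : exists D (u : 'I_D -> multinom n), mnm_basis X u.
Proof.
pose P r := `[< exists u : 'I_r -> multinom n,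
  (forall i, X (u i)) /\ row_free (mnm_mx u) >].
have exP : exists r, P r.
  exists 0%N; apply/asboolP; exists (fun=> mnm0); split=> [[]//|].
  by rewrite /row_free -leqn0 rank_leq_row.
have leP r : P r -> (r <= n)%N.
  by move=> /asboolP [u [_ /eqP <-]]; exact: rank_leq_col.
have [r /asboolP [u [uX uf]] rmax] := ex_maxnP exP leP.
exists r, u; split=> // v Xv; apply/negPn/negP => vu.
suff /rmax : P (r + 1)%N by rewrite addn1 ltnn.
apply/asboolP; exists (fun i => if fintype.split i is inl j then u j else v).
split=> [i|]; first by case: (fintype.split i).
have -> : mnm_mx (fun i => if fintype.split i is inl j then u j else v) =
    col_mx (mnm_mx u) (mnm_row v).
  by apply/matrixP => i j; rewrite !mxE; case: (fintype.split i) => l; rewrite !mxE.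
rewrite /row_free eqn_leq rank_leq_row /=.
suff : (r < \rank (col_mx (mnm_mx u) (mnm_row v)))%N by rewrite -addn1.
rewrite -[X in (X < _)%N](eqP uf) rank_ltmx //.
rewrite ltmxE -addsmxE addsmxSl /=; apply: contra vu.
by rewrite -addsmxE addsmx_sub => /andP[].
Qed.

Lemma mnm_row_inj : injective mnm_row.
Proof.
move=> v w /rowP vw; apply/mnmP => j; have := vw j; rewrite !mxE.
by move=> /eqP; rewrite eqr_nat => /eqP.
Qed.

(** Some [D] columns of the matrix, indexed by [J], already have rank [D], so a vector of the row
    space is determined by its entries there. *)
Lemma mnm_coords D (u : 'I_D -> multinom n) : row_free (mnm_mx u) ->
  exists J : 'I_D -> 'I_n, forall v w,
    (mnm_row v <= mnm_mx u)%MS -> (mnm_row w <= mnm_mx u)%MS ->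
    (forall i, v (J i) = w (J i)) -> v = w.
Proof.
move=> uf; have fU : row_full (mnm_mx u)^T by rewrite /row_full mxrank_tr.
exists (fullrankfun fU) => v w /submxP [a va] /submxP [b wb] vw.
apply: mnm_row_inj; rewrite va wb; congr (_ *m _).
have /row_free_inj : row_free (colsub (fullrankfun fU) (mnm_mx u)).
  by rewrite /row_free -mxrank_tr trmx_mxsub mxrank_fullrowsub.
apply; rewrite /= !mulmx_colsub -va -wb.
by apply/rowP => i; rewrite !mxE vw.
Qed.

Lemma card_mnm_basis X D (u : 'I_D -> multinom n) N : mnm_basis X u ->
  (#|[pred v : bmultinom n N.+1 | `[< X v >]]| <= N.+1 ^ D)%N.
Proof.
move=> [uX uf uspan]; have [J Jinj] := mnm_coords uf.
(* The coordinates kept are bounded by the degree, hence by [N]. *)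
pose h (v : bmultinom n N.+1) : {ffun 'I_D -> 'I_N.+1} :=
  [ffun i => inord (bmnm v (J i))].
rewrite -(@card_in_imset _ _ h).
  by apply: leq_trans (max_card _) _; rewrite card_ffun !card_ord.
move=> v w; rewrite !inE => Xv Xw /ffunP hvw.
apply/val_inj/Jinj; [exact: uspan|exact: uspan|] => i.
have ltN (x : bmultinom n N.+1) : (bmnm x (J i) < N.+1)%N.
  apply: leq_ltn_trans (bmdeg x); rewrite mdegE (bigD1 (J i)) //=.
  exact: leq_addr.
by have := hvw i; rewrite !ffunE => /(congr1 val) /=; rewrite !inordK.
Qed.

(** The exponent of the image of the monomial [a] under the monomial map y_i |-> x^(u i). *)
Definition mnm_comb D (u : 'I_D -> multinom n) (a : multinom D) : multinom n :=
  \big[@mnm_add n/mnm0]_i mnm_muln (u i) (a i).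

Lemma mnm_combE D (u : 'I_D -> multinom n) a j :
  mnm_comb u a j = (\sum_i u i j * a i)%N.
Proof. by rewrite mnm_sumE; apply: eq_bigr => i _; rewrite mulmnE. Qed.

Lemma mnm_comb_inj D (u : 'I_D -> multinom n) : row_free (mnm_mx u) ->
  injective (mnm_comb u).
Proof.
move=> /row_free_inj uI a b ab.
have rowE c : mnm_row (mnm_comb u c) = (\row_i (c i)%:R) *m mnm_mx u.
  apply/rowP => j; rewrite !mxE mnm_combE natr_sum; apply: eq_bigr => i _.
  by rewrite !mxE natrM mulrC.
have /uI /rowP E : (\row_i (a i)%:R : 'rV[rat]_D) *m mnm_mx u =
  (\row_i (b i)%:R) *m mnm_mx u by rewrite -!rowE ab.
by apply/mnmP => i; have := E i; rewrite !mxE => /eqP; rewrite eqr_nat => /eqP.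
Qed.

End MonomialRank.

(** * Hilbert functions counted by initial exponents *)

Section InitialGrowth.
Variables (k : fieldType) (n : nat) (lt : rel (multinom n)).
Hypothesis hlt : monomial_order lt.

Definition initial_exponents (A : {pred mpoly n k}) : set (multinom n) :=
  [set u | exists2 g, g \in A & is_initial lt g u].

Lemma is_initial1 : is_initial lt (1 : mpoly n k) mnm0.
Proof. by rewrite /is_initial msupp1; split=> [|v]; rewrite inE // => ->. Qed.

Lemma is_initialX e (p : mpoly n k) u :
  is_initial lt p u -> is_initial lt (p ^+ e) (mnm_muln u e).
Proof.
move=> pu; elim: e => [|e IH]; first by rewrite expr0 mulm0n; exact: is_initial1.
by rewrite exprS mulmS; apply: is_initialM.
Qed.

Lemma is_initial_mmap1 D (x : 'I_D -> mpoly n k) (u : 'I_D -> multinom n) a :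
  (forall i, is_initial lt (x i) (u i)) ->
  is_initial lt (mmap1 x a) (mnm_comb u a).
Proof.
move=> xu; rewrite /mmap1 /mnm_comb.
elim/big_ind2: _ => [|p v q w|i _]; first exact: is_initial1.
  exact: is_initialM.
exact: is_initialX.
Qed.

Lemma mcoeff_pihomog d (p : mpoly n k) v :
  mcoeff v (pihomog mdeg d p) = if mdeg v == d then mcoeff v p else 0.
Proof.
rewrite pihomogE raddf_sum /= [in RHS](mpolyE p) raddf_sum /=.
case: eqP => [dv|/eqP dv].
  rewrite big_mkcond /=; apply: eq_bigr => w _; rewrite mcoeffZ mcoeffX.
  by case: (eqVneq w v) => [->|_]; rewrite ?dv ?eqxx ?mulr0 ?if_same.
rewrite big1 // => w /eqP dw; rewrite mcoeffZ mcoeffX.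
by case: eqP => [wv|_]; rewrite ?mulr0 // -wv dw eqxx in dv *.
Qed.

Lemma is_initial_pihomog (p : mpoly n k) u :
  is_initial lt p u -> is_initial lt (pihomog mdeg (mdeg u) p) u.
Proof.
move=> [up umax]; split.
  by rewrite mcoeff_msupp mcoeff_pihomog eqxx -mcoeff_msupp.
move=> v; rewrite mcoeff_msupp mcoeff_pihomog.
by case: ifP => [_|]; rewrite ?eqxx // -mcoeff_msupp; exact: umax.
Qed.

(** Every nonzero element of the span has its initial exponent among those counted by
    [card_mnm_basis]. For a nonzero polynomial [mmeasure mdeg] is one more than the degree, so
    [N.+1] stands for degree at most [N]. *)
Lemma subalg_lin_indep_le (A : subalgClosed (mpoly n k)) D
    (u : 'I_D -> multinom n) N (T : finType) (x : T -> mpoly n k) :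
  mnm_basis (initial_exponents A) u ->
  (forall t, x t \in A /\ (mmeasure mdeg (x t) <= N.+1)%N) -> lin_indep x ->
  (#|T| <= N.+1 ^ D)%N.
Proof.
move=> uB xA xI; apply: leq_trans (card_mnm_basis N uB).
pose W : set (mpoly n k) := [set p | p \in A /\ (mmeasure mdeg p <= N.+1)%N].
rewrite [X in (_ <= X)%N]cardE -(size_map (@bmnm n N.+1)).
apply: (@lin_indep_le_supp _ _ _ _ W) xI => //.
  split=> [|a p q [pA pN] [qA qN]]; first by split; rewrite ?rpred0 ?mmeasure0.
  split; first by rewrite rpredD ?rpredZ.
  apply: leq_trans (msizeD_le _ _) _; rewrite geq_max qN andbT.
  by apply: leq_trans pN; exact: msizeZ_le.
move=> w [wA wN] /(ex_initial hlt) [v vw]; exists v; last by case: vw.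
have vN : (mdeg v < N.+1)%N.
  by apply: leq_trans wN; apply: msize_mdeg_lt; case: vw.
apply/mapP; exists (BMultinom vN) => //; rewrite mem_enum inE.
by exists w.
Qed.

End InitialGrowth.

Section HilbertFunction.
Variable n : nat.
Implicit Type X : set (multinom n).

Definition hilb X d : nat :=
  #|[pred v : bmultinom n d.+1 | (mdeg v == d) && `[< X v >]]|.

Lemma hilb_widen X d N : (d <= N)%N ->
  hilb X d = #|[pred v : bmultinom n N.+1 | (mdeg v == d) && `[< X v >]]|.
Proof.
move=> dN.
have widenP (v : bmultinom n d.+1) : (mdeg v < N.+1)%N.
  by apply: leq_trans (bmdeg v) _; rewrite ltnS.
pose h (v : bmultinom n d.+1) : bmultinom n N.+1 := BMultinom (widenP v).
have hI : injective h by move=> v w /(congr1 (@bmnm _ _)) /= /val_inj.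
rewrite /hilb -(card_imset _ hI); apply: eq_card => v; rewrite inE.
apply/imsetP/idP => [[w + ->]|vP]; first by rewrite inE.
have vd : (mdeg v < d.+1)%N by case/andP: vP => /eqP ->.
by exists (BMultinom vd); [rewrite inE | exact: val_inj].
Qed.

Lemma sum_hilb X N : (\sum_(d < N.+1) hilb X d)%N =
  #|[pred v : bmultinom n N.+1 | `[< X v >]]|.
Proof.
rewrite -sum1_card (partition_big
  (fun v : bmultinom n N.+1 => inord (mdeg v) : 'I_N.+1) xpredT) //=.
apply: eq_bigr => d _; rewrite sum1_card (@hilb_widen _ _ N) ?leq_ord //.
apply: eq_card => v; rewrite !inE /= unfold_in /= inE andbC; congr andb.
by rewrite -val_eqE /= inordK // bmdeg.
Qed.

Lemma mnm_comb_mem X D (u : 'I_D -> multinom n) a : X mnm0 ->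
  (forall v w, X v -> X w -> X (mnm_add v w)) -> (forall i, X (u i)) ->
  X (mnm_comb u a).
Proof.
move=> X0 XD Xu; rewrite /mnm_comb; elim/big_rec: _ => // i v _ Xv; apply: (XD) Xv.
by elim: (a i) => [|b IH]; rewrite ?mulm0n // mulmS; apply: XD.
Qed.

Lemma mdeg_mnm_comb D (u : 'I_D -> multinom n) a :
  mdeg (mnm_comb u a) = (\sum_i mdeg (u i) * a i)%N.
Proof. by rewrite mdeg_sum; apply: eq_bigr => i _; rewrite mdegMn. Qed.

Lemma sum_hilb_ge X D (u : 'I_D -> multinom n) : X mnm0 ->
  (forall v w, X v -> X w -> X (mnm_add v w)) -> mnm_basis X u ->
  exists2 c, (0 < c)%N &
    forall N, (N.+1 ^ D <= \sum_(d < (c * N).+1) hilb X d)%N.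
Proof.
(* A combination with coefficients up to [N] has degree at most [N] times the sum of the degrees;
   the successor keeps the constant positive for [D = 0]. *)
move=> X0 XD [uX uf _]; exists (\sum_i mdeg (u i)).+1 => // N.
rewrite sum_hilb; set c := (_.+1 * N)%N.
pose a (h : {ffun 'I_D -> 'I_N.+1}) : multinom D :=
  Multinom [tuple nat_of_ord (h i) | i < D].
have aE h i : a h i = h i by rewrite /a mnmE.
have aP h : (mdeg (mnm_comb u (a h)) < c.+1)%N.
  rewrite ltnS mdeg_mnm_comb /c mulSn big_distrl /= -[X in (X <= _)%N]add0n.
  by rewrite leq_add // leq_sum // => i _; rewrite leq_mul2l aE leq_ord orbT.
have hI : injective (fun h => BMultinom (aP h)).
  move=> h h' /(congr1 (@bmnm _ _)) /= /(mnm_comb_inj uf) /mnmP hh'.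
  by apply/ffunP => i; apply: val_inj; have := hh' i; rewrite !aE.
have := card_imset predT hI; rewrite cardT -cardE card_ffun !card_ord => <-.
apply/subset_leq_card/fintype.subsetP => v /imsetP [h _ ->]; rewrite inE.
exact: mnm_comb_mem.
Qed.

End HilbertFunction.

Section SubalgebraDimension.
Variables (k : fieldType) (n : nat) (G : set (mpoly n k)).
Hypothesis Ghom : forall g, G g -> exists d, g \is ishomog1 d mdeg.
Local Notation A := (gen_subalg G).
Local Notation sval := (@subalgebra_val k n G).

Lemma subalgebra_valP (a : subalgebra G) : sval a \in A.
Proof. exact: (valP a). Qed.

Lemma subalgebra_val_sum (T : Type) (s : seq T) (P : pred T) (c : T -> k)
    (a : T -> subalgebra G) :
  sval (\sum_(t <- s | P t) c t *: a t) = \sum_(t <- s | P t) c t *: sval (a t).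
Proof.
rewrite -[LHS]/(\val _) raddf_sum; apply: eq_bigr => t _.
exact: linearZ.
Qed.

Lemma lin_indep_val (T : finType) (a : T -> subalgebra G) :
  lin_indep (fun t => sval (a t)) <-> lin_indep a.
Proof.
split=> aI c; first by move=> /(congr1 sval); rewrite subalgebra_val_sum => /aI.
rewrite -subalgebra_val_sum => c0; apply: aI.
by apply: (@val_inj _ _ (subalgebra G)); exact: c0.
Qed.

Variable lt : rel (multinom n).
Hypothesis hlt : monomial_order lt.

Lemma initial_exponents0 : initial_exponents lt A mnm0.
Proof. by exists 1; [exact: rpred1 | exact: is_initial1]. Qed.

Lemma initial_exponentsD u v : initial_exponents lt A u ->
  initial_exponents lt A v -> initial_exponents lt A (mnm_add u v).
Proof.
move=> [g gA gu] [h hA hv].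
by exists (g * h); [exact: rpredM | exact: is_initialM].
Qed.

Lemma initial_homog u : initial_exponents lt A u ->
  exists a : subalgebra G, std_grading G (mdeg u) a /\ is_initial lt (sval a) u.
Proof.
move=> [g gA gu]; have hA := pihomog_gen_subalg Ghom (mdeg u) gA.
exists (Subalgebra hA); split; first exact: pihomogP.
exact: is_initial_pihomog.
Qed.

Lemma std_grading_lin_closed d : lin_closed (std_grading G d).
Proof. by split=> [|c a b ha hb]; [exact: rpred0|apply: rpredD => //; exact: rpredZ]. Qed.

Lemma std_grading_lin_indep d (T : finType) (a : T -> subalgebra G) :
  (forall t, std_grading G d (a t)) -> lin_indep a ->
  (#|T| <= hilb (initial_exponents lt A) d)%N.
Proof.
move=> ad /lin_indep_val aI.
rewrite /hilb [X in (_ <= X)%N]cardE -(size_map (@bmnm n d.+1)).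
apply: (@lin_indep_le_supp _ _ _ _ [set p | p \in A /\ p \is ishomog1 d mdeg]) aI.
- split=> [|c p q [pA pd] [qA qd]]; first by rewrite /= !rpred0.
  by split; apply: rpredD => //; apply: rpredZ.
- by move=> t; split; [exact: subalgebra_valP | exact: ad].
move=> w [wA /dhomog_mf wd] /(ex_initial hlt) [v vw]; exists v; last by case: vw.
have vd : mdeg v = d by apply: wd; case: vw.
have vN : (mdeg v < d.+1)%N by rewrite vd.
apply/mapP; exists (BMultinom vN) => //; rewrite mem_enum inE /= vd eqxx.
by apply/asboolP; exists w.
Qed.

(** Initial exponents of degree [d] are those of homogeneous elements of degree [d]: such elements
    are independent when the exponents differ, and no nonzero element avoids these exponents. *)
Lemma has_dim_std_grading d :
  has_dim (std_grading G d) (hilb (initial_exponents lt A) d).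
Proof.
have ub r (v : 'I_r -> subalgebra G) : (forall t, std_grading G d (v t)) ->
    lin_indep v -> (r <= hilb (initial_exponents lt A) d)%N.
  by move=> vd vI; rewrite -[r]card_ord; exact: std_grading_lin_indep vI.
have [r rdim] := lin_closed_has_dim (std_grading_lin_closed d) ub.
suff -> : hilb (initial_exponents lt A) d = r by [].
apply/eqP; rewrite eqn_leq; apply/andP; split; last first.
  by case: rdim => b [bd _ bI]; exact: ub bI.
pose S := [pred v : bmultinom n d.+1 |
  (mdeg v == d) && `[< initial_exponents lt A v >]].
have /choice [a aP] : forall t : {v | v \in S}, exists a : subalgebra G,
    std_grading G d a /\ is_initial lt (sval a) (\val t).
  move=> [v /=]; rewrite inE => /andP[/eqP vd /asboolP/initial_homog].
  by rewrite vd.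
rewrite /hilb -card_sig; apply: (has_dim_vdim_indep rdim (v := a)).
  by move=> t; case: (aP t).
apply/lin_indep_val.
apply: (@initial_lin_indep _ _ _ hlt _ _ (fun t => bmnm (\val t))).
  by move=> s t /val_inj/val_inj.
by move=> t; case: (aP t).
Qed.

End SubalgebraDimension.

Section InitialAlgebraInitial.
Variables (k : fieldType) (n : nat) (lt : rel (multinom n)).
Hypothesis hlt : monomial_order lt.
Variable A : subalgClosed (mpoly n k).
Local Notation I := (initial_monomials lt A).

Lemma initial_monomials_homog g : I g -> exists d, g \is ishomog1 d mdeg.
Proof. by move=> [h [u [_ _ ->]]]; exists (mdeg u); rewrite dhomogX. Qed.

(** The polynomials all of whose monomials are initial exponents of [A] form an algebra containing
    the initial monomials, so no new exponent can arise. *)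
Lemma initial_exponents_initial_algebra :
  initial_exponents lt (gen_subalg I) = initial_exponents lt A.
Proof.
pose B := [pred p : mpoly n k |
  `[< forall u, u \in msupp p -> initial_exponents lt A u >]].
have IB : {subset gen_subalg I <= B}.
  apply: gen_subalg_min => [|g [h [u [hA hu ->]]]]; last first.
    by apply/asboolP => v; rewrite msuppX inE => /eqP ->; exists h.
  split=> [|a p q /asboolP pB /asboolP qB|p q /asboolP pB /asboolP qB];
    apply/asboolP => u.
  - rewrite msupp1 inE => /eqP ->; exists 1; [exact: rpred1|exact: is_initial1].
  - move=> /msuppD_le; rewrite mem_cat => /orP[/msuppZ_le/pB|/qB] //.
  - move=> /msuppM_le /allpairsP [[v w] /= [/pB [g gA gv] /qB [h hA hw] ->]].
    by exists (g * h); [exact: rpredM | exact: is_initialM].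
rewrite eqEsubset; split=> u [g gA gu].
  by have /asboolP := IB _ gA; apply; case: gu.
exists (mpolyX k u); first by apply: gen_subalg_gen; exists g, u.
by rewrite /is_initial msuppX; split=> [|v]; rewrite inE // => ->.
Qed.

End InitialAlgebraInitial.

Lemma rmorph_mmap (r : nat) (k S S' : comNzRingType) (phi : {rmorphism S -> S'})
    (f : k -> S) (h : 'I_r -> S) (p : mpoly r k) :
  phi (mmap f h p) = mmap (phi \o f) (phi \o h) p.
Proof.
rewrite /mmap rmorph_sum; apply: eq_bigr => m _; rewrite rmorphM /mmap1.
by rewrite rmorph_prod; congr (_ * _); apply: eq_bigr => i _; rewrite rmorphXn.
Qed.

(** With N = c^D, (c N + 1)^D <= c^D (N + 1)^D < (N + 1)^(D + 1). *)
Lemma expn_gt_growth (c D r : nat) : (0 < c)%N -> (D < r)%N ->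
  exists N, ((c * N).+1 ^ D < N.+1 ^ r)%N.
Proof.
move=> c0 Dr; exists (c ^ D)%N.
apply: (@leq_ltn_trans ((c * (c ^ D).+1) ^ D)%N).
  have le_exp m m' e : (m <= m' -> m ^ e <= m' ^ e)%N.
    by case: e => // e mm'; rewrite leq_exp2r.
  by apply: le_exp; rewrite mulnS -add1n leq_add2r.
rewrite expnMn; apply: (@leq_trans ((c ^ D).+1 ^ D.+1)%N); last first.
  by rewrite leq_exp2l // ltnS expn_gt0 c0.
by rewrite expnS ltn_mul2r expn_gt0 /=.
Qed.

(** * Chains of primes and transcendence degree *)

Section PrimeIdeals.
Variable A : comNzRingType.
Implicit Types (P : set A).

Lemma prime_idealP P : prime_ideal P <->
  [/\ P 0, ~ P 1, forall u v, P u -> P v -> P (u + v),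
      forall a u, P u -> P (a * u) & forall u v, P (u * v) -> P u \/ P v].
Proof.
have E x : x \in mem P <-> P x by split; rewrite inE.
split=> [[[/E P0 P1 PD] Pp]|[P0 P1 PD PM Pp]].
- split=> // [/E P1'|u v /E Pu /E Pv|a u /E Pu|u v /E/Pp /orP[] /E].
  + by rewrite P1' in P1.
  + by apply/E; rewrite -[u]mul1r PD.
  + by apply/E; rewrite -[X in X \in _]addr0 PD //; apply/E.
  + by left.
  + by right.
split; first split.
- exact/E.
- by apply/negP => /E.
- by move=> a u v /E Pu /E Pv; apply/E/PD => //; exact: PM.
- by move=> u v /E /Pp[] /E ->; rewrite ?orbT.
Qed.

End PrimeIdeals.

Section KrullLeTranscendence.
Variables (k : fieldType) (A : comNzRingType) (iota : {rmorphism k -> A}).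

(* Expanding a nonzero polynomial in powers of the last variable, which lies in
   [P 1] but not in [P 0], the lowest power that occurs can be divided out. *)
Lemma prime_chain_eval r (P : nat -> set A) (x : 'I_r -> A) (p : mpoly r k) :
  (forall i, (i <= r)%N -> prime_ideal (P i)) ->
  (forall i, (i < r)%N -> P i `<=` P i.+1) ->
  (forall i : 'I_r, P (r - i)%N (x i) /\ ~ P (r - i).-1 (x i)) ->
  p != 0 -> ~ P 0%N (mmap iota x p).
Proof.
elim: r P x p => [|r IH] P x p Pprime Psub xP p0.
  have [P0 P1 PD PM _] := (prime_idealP _).1 (Pprime 0%N (leqnn _)).
  rewrite [p]nvar0_mpolyC in p0 *; rewrite mmapC => Pc; apply: P1.
  have c0 : mcoeff mnm0 p != 0.
    by apply: contraNneq p0 => ->; rewrite mpolyC0.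
  by rewrite -(rmorph1 iota) -(mulVf c0) rmorphM; exact: PM.
have [P0 P1 PD PM Pp] := (prime_idealP _).1 (Pprime 0%N isT).
have [Q0 Q1 QD QM Qp] := (prime_idealP _).1 (Pprime 1%N isT).
pose phi (m : multinom r.+1) : multinom r :=
  Multinom [tuple m (widen_ord (leqnSn r) i) | i < r].
pose x' i := x (widen_ord (leqnSn r) i).
have mmap1E m : mmap1 x m = mmap1 x' (phi m) * x ord_max ^+ m ord_max.
  by rewrite /mmap1 big_ord_recr; congr (_ * _); apply: eq_bigr => i _; rewrite mnmE.
have phiI m m' : phi m = phi m' -> m ord_max = m' ord_max -> m = m'.
  move=> /mnmP E E'; apply/mnmP => i.
  have [j ->|->//] := unliftP ord_max i.
  have := E j; rewrite !mnmE.
  by have -> : widen_ord (leqnSn r) j = lift ord_max j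
    by apply: val_inj; rewrite /= /bump leqNgt ltn_ord.
have [m0 m0p m0min] : exists2 m0, m0 \in msupp p &
    forall m, m \in msupp p -> (m0 ord_max <= m ord_max)%N.
  have exj : exists j, has (fun m : multinom r.+1 => m ord_max == j) (msupp p).
    by exists ((mlead p) ord_max); apply/hasP; exists (mlead p) => //; exact: mlead_supp.
  have [j /hasP [m0 m0p /eqP <-] jmin] := ex_minnP exj.
  by exists m0 => // m mp; apply: jmin; apply/hasP; exists m.
set j0 := m0 ord_max in m0min.
pose q := \sum_(m <- msupp p | m ord_max == j0) mcoeff m p *: mpolyX k (phi m).
have q0 : q != 0.
  apply/eqP => q0; move: (m0p); rewrite mcoeff_msupp => /negP; apply.
  have := congr1 (mcoeff (phi m0)) q0; rewrite mcoeff0 /q raddf_sum /=.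
  rewrite (big_rem m0) //= eqxx mcoeffZ mcoeffX eqxx mulr1.
  rewrite [X in _ + X]big1_seq ?addr0; first by move=> /eqP.
  move=> m /andP[/eqP mj]; rewrite mem_rem_uniq ?msupp_uniq // inE.
  move=> /andP[mm0 _]; rewrite mcoeffZ mcoeffX.
  by case: eqP => [/phiI/(_ mj)/eqP|_]; rewrite ?mulr0 // (negbTE mm0).
have [t xpE] : exists t,
    mmap iota x p = x ord_max ^+ j0 * (x ord_max * t + mmap iota x' q).
  exists (\sum_(m <- msupp p | m ord_max != j0)
    iota (mcoeff m p) * mmap1 x' (phi m) * x ord_max ^+ (m ord_max - j0).-1).
  rewrite /q raddf_sum /= mulrDr !mulr_sumr addrC.
  rewrite [LHS](bigID (fun m : multinom r.+1 => m ord_max == j0)) /=.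
  congr (_ + _); rewrite big_seq_cond [RHS]big_seq_cond; apply: eq_bigr.
    move=> m /andP[_ /eqP mj]; rewrite mmapZ mmapX mmap1E mj.
    by rewrite [RHS]mulrC mulrA.
  move=> m /andP[mp mj]; rewrite mmap1E mulrA [RHS]mulrA -exprSr [RHS]mulrC.
  rewrite -[RHS]mulrA -exprD; congr (_ * _ ^+ _).
  have := m0min _ mp; rewrite leq_eqVlt eq_sym (negbTE mj) /= => lt_j0.
  by rewrite -subnS subnK.
have [] : P 1%N (x ord_max) /\ ~ P 0%N (x ord_max).
  by have := xP ord_max; rewrite /= subSnn.
move=> x1 x0; rewrite xpE => /Pp[Px|].
  apply: x0; elim: (j0) Px => [|j IHj]; first by rewrite expr0.
  by rewrite exprS => /Pp[].
(* Modulo [P 1], which contains [x ord_max], only the value of [q] remains; the induction hypothesis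
   applies to the chain starting at [P 1]. *)
move=> /(Psub 0%N isT) P1q.
apply: (IH (fun i => P i.+1) x' q) => //.
- by move=> i ir; exact: Pprime.
- by move=> i ir; exact: Psub.
- move=> i; have := xP (widen_ord (leqnSn r) i); rewrite /= subSn 1?ltnW //=.
  by rewrite prednK // subn_gt0.
have := QD _ _ P1q (QM (- t) _ x1).
by rewrite mulNr mulrC addrAC subrr add0r.
Qed.

End KrullLeTranscendence.

Section DimensionInequalities.
Variable R : realType.

Lemma gr_krull_dim_le (A : comNzRingType) (gr : nat -> set A) :
  (gr_krull_dim R gr <= krull_dim R A)%E.
Proof.
apply: le_ereal_sup => _ [r [P [Pprime Psub]] <-]; exists r => //.
by exists P; split=> // i ir; split=> //; case: (Pprime i ir).
Qed.

Lemma tofrac_alg_indep (k : fieldType) (A : idomainType)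
    (iota : {rmorphism k -> A}) r (a : 'I_r -> A) :
  (forall p : mpoly r k, mmap iota a p = 0 -> p = 0) ->
  (r%:R%:E <= trdeg R iota)%E.
Proof.
move=> aI; apply: ereal_sup_ubound; exists r => //.
exists (@tofrac A \o a) => p; rewrite -rmorph_mmap => /eqP.
by rewrite tofrac_eq0 => /eqP/aI.
Qed.

Lemma krull_dim_le_trdeg (k : fieldType) (A : idomainType)
    (iota : {rmorphism k -> A}) : (krull_dim R A <= trdeg R iota)%E.
Proof.
apply: ge_ereal_sup => _ [r [P [Pprime Psub]] <-].
(* One element is taken from each step of the chain, from the top down, so that the last variable
   lies in [P 1] as [prime_chain_eval] requires. *)
have /choice [x xP] : forall i : 'I_r, exists a,
    P (r - i)%N a /\ ~ P (r - i).-1 a.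
  move=> i; have [] : P (r - i).-1 `<` P (r - i).-1.+1.
    by apply: Psub; rewrite prednK ?subn_gt0 // leq_subr.
  rewrite prednK ?subn_gt0 // => _ /existsNP [a /not_implyP [Pa nPa]].
  by exists a.
apply: (tofrac_alg_indep (a := x)) => p px0; apply/eqP/negPn/negP => p0.
apply: (@prime_chain_eval _ _ iota r P x p) => //.
- by move=> i /Pprime [].
- by move=> i /Psub [].
rewrite px0; have [[]] := Pprime 0%N (leq0n _).
by move=> P0ideal P0prime _; case: ((prime_idealP _).1 (conj P0ideal P0prime)).
Qed.

Lemma common_denominator (A : idomainType) r (x : 'I_r -> {fraction A}) :
  exists2 b : A, b != 0 & exists a : 'I_r -> A, forall i, tofrac b * x i = tofrac (a i).
Proof.
have /choice [nd ndP] : forall i, exists nd : A * A,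
    nd.2 != 0 /\ tofrac nd.2 * x i = tofrac nd.1.
  move=> i; elim/quotW: (x i) => y; exists (frac y).
  split; first exact: denom_ratioP.
  rewrite -[LHS]/(FracField.mul _ _) !piE; apply/eqmodP.
  rewrite /= FracField.equivfE /FracField.mulf.
  by rewrite !numden_Ratio ?mulf_neq0 ?oner_neq0 ?denom_ratioP // mul1r mulr1.
exists (\prod_i (nd i).2); first by apply/prodf_neq0 => i _; case: (ndP i).
exists (fun i => (\prod_(j | j != i) (nd j).2) * (nd i).1) => i.
rewrite [X in tofrac X * _](bigD1 i) //= !tofracM mulrAC mulrC.
by case: (ndP i) => _ ->.
Qed.

End DimensionInequalities.

(** * Growth, transcendence degree and Gelfand-Kirillov dimension *)

Section LogGrowth.
Variable R : realType.

Lemma near_div_ln (C e : R) : 0 < e ->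
  \forall N \near \oo, 0 < ln (N%:R : R) /\ C / ln (N%:R : R) <= e.
Proof.
move=> e0; have := (@cvgr_idn R); rewrite cvgryPge => /(_ (expR (Num.max (C / e) 1))).
apply: filterS => N leN.
have lnN : Num.max (C / e) 1 <= ln (N%:R : R).
  by rewrite -[X in X <= _]expRK ler_ln ?posrE ?expR_gt0 // (lt_le_trans (expR_gt0 _) leN).
have lnN0 : 0 < ln (N%:R : R).
  by apply: lt_le_trans lnN; rewrite lt_max ltr01 orbT.
split=> //; rewrite ler_pdivrMr // -ler_pdivrMl // mulrC.
by apply: le_trans lnN; rewrite le_max lexx.
Qed.

(** For N > 0 the bound is at most ((c + 1) N)^D, and the constant D ln (c + 1) vanishes after
    division by ln N. *)
Lemma limn_esup_ln_le (d : nat -> nat) (c D : nat) :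
  (forall N, (d N <= (c * N).+1 ^ D)%N) ->
  (limn_esup (fun N => (ln (d N)%:R / ln N%:R : R)%:E) <= D%:R%:E)%E.
Proof.
move=> dle; apply/lee_addgt0Pr => e e0.
have [N0 _ N0P] := near_div_ln (D%:R * ln (c.+1%:R : R)) e0.
apply: (@le_trans _ _ (ereal_sup
    [set (ln (d N)%:R / ln N%:R : R)%:E | N in [set N | (N0 <= N)%N]])).
  by apply: ereal_inf_lbound; exists [set N | (N0 <= N)%N] => //; exists N0.
apply: ge_ereal_sup => _ [N /N0P [lnN0 CN] <-]; rewrite -EFinD lee_fin.
have N1 : (0 < N)%N by rewrite lt0n; apply: contraTneq lnN0 => ->; rewrite ln0 ?ltxx.
apply: le_trans (lerD (lexx _) CN).
rewrite ler_pdivrMr // mulrDl divfK ?gt_eqF // -mulrDr.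
(* Since [ln 0] is 0 by convention, the case [d N = 0] only asks for a nonnegative right-hand
   side. *)
case: (posnP (d N)) => [->|dN0].
  by rewrite ln0 // mulr_ge0 // addr_ge0 // ln_ge0 // ler1n.
rewrite addrC -lnM ?posrE ?ltr0n // (mulr_natl _ D) -lnXn ?mulr_gt0 ?ltr0n //.
rewrite ler_ln ?posrE ?ltr0n ?exprn_gt0 ?mulr_gt0 ?ltr0n //.
rewrite -natrM -natrX ler_nat; apply: leq_trans (dle N) _.
have le_exp m m' e' : (m <= m' -> m ^ e' <= m' ^ e')%N.
  by case: e' => // e' mm'; rewrite leq_exp2r.
by apply: le_exp; rewrite mulSn -add1n leq_add2r.
Qed.

(** As N / s is below [(N %/ s).+1], the logarithm is at least D ln N - D ln s. *)
Lemma limn_esup_ln_ge (d : nat -> nat) (s D : nat) : (0 < s)%N ->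
  (forall N, ((N %/ s).+1 ^ D <= d N)%N) ->
  (D%:R%:E <= limn_esup (fun N => (ln (d N)%:R / ln N%:R : R)%:E))%E.
Proof.
move=> s0 dge; apply: le_ereal_inf_tmp => _ [V VF <-].
apply/lee_addgt0Pr => e e0.
have [N [VN [lnN0 CN]]] : exists N, V N /\
    0 < ln (N%:R : R) /\ D%:R * ln (s%:R : R) / ln (N%:R : R) <= e.
  have [N [VN CN]] := filter_ex (filterI VF
    (near_div_ln (D%:R * ln (s%:R : R)) e0)).
  by exists N.
apply: (@le_trans _ _ ((ln (d N)%:R / ln N%:R : R)%:E + e%:E)%E); last first.
  by rewrite leeD2r //; apply: ereal_sup_ubound; exists N.
have N1 : (0 < N)%N by rewrite lt0n; apply: contraTneq lnN0 => ->; rewrite ln0 ?ltxx.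
rewrite -EFinD lee_fin; apply: le_trans (lerD (lexx _) CN).
rewrite -mulrDl ler_pdivlMr // -lerBlDr -mulrBr -ln_div ?posrE ?ltr0n //.
rewrite (mulr_natl _ D) -lnXn ?divr_gt0 ?ltr0n //.
have dN0 : (0 < d N)%N by apply: leq_trans (dge N); rewrite expn_gt0.
rewrite ler_ln ?posrE ?ltr0n ?exprn_gt0 ?divr_gt0 ?ltr0n //.
apply: (@le_trans _ _ ((N %/ s).+1%:R ^+ D)); last by rewrite -natrX ler_nat.
rewrite lerXn2r ?nnegrE ?divr_ge0 ?ler0n //.
by rewrite ler_pdivrMr ?ltr0n // -natrM ler_nat ltnW // ltn_ceil.
Qed.

End LogGrowth.

Section DegreeBound.
Variables (k : fieldType) (n : nat).
Implicit Types (p q : mpoly n k) (c d : nat).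

Definition deg_le c p : Prop := forall v, v \in msupp p -> (mdeg v <= c)%N.

Lemma deg_leE c p : deg_le c p <-> (mmeasure mdeg p <= c.+1)%N.
Proof.
split=> [pc|pc v /msize_mdeg_lt vp]; last by rewrite -ltnS (leq_trans vp).
by rewrite msizeE; apply/bigmax_leqP_seq => v /pc.
Qed.

Lemma deg_leW c d p : (c <= d)%N -> deg_le c p -> deg_le d p.
Proof. by move=> cd pc v /pc vc; exact: leq_trans cd. Qed.

Lemma deg_le_lin_closed c : lin_closed [set p | deg_le c p].
Proof.
split=> [v|a p q pc qc v]; first by rewrite msupp0.
by move=> /msuppD_le; rewrite mem_cat => /orP[/msuppZ_le/pc|/qc].
Qed.

Lemma deg_le_sum (T : Type) (s : seq T) (P : pred T) (l : T -> k)
    (x : T -> mpoly n k) c :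
  (forall t, P t -> deg_le c (x t)) ->
  deg_le c (\sum_(t <- s | P t) l t *: x t).
Proof. exact: (lin_closed_sum s l (deg_le_lin_closed c)). Qed.

Lemma deg_leM c d p q : deg_le c p -> deg_le d q -> deg_le (c + d) (p * q).
Proof.
move=> pc qd v /msuppM_le /allpairsP [[a b] /= [/pc ac /qd bd ->]].
by rewrite mdegD leq_add.
Qed.

Lemma deg_le_prod (I : Type) (s : seq I) (P : pred I) (F : I -> mpoly n k)
    (c : I -> nat) :
  (forall i, P i -> deg_le (c i) (F i)) ->
  deg_le (\sum_(i <- s | P i) c i) (\prod_(i <- s | P i) F i).
Proof.
move=> Fc; elim/big_ind2: _ => //; last by move=> *; exact: deg_leM.
by move=> v; rewrite msupp1 inE => /eqP ->; rewrite mdeg0.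
Qed.

Lemma deg_leX c e p : deg_le c p -> deg_le (e * c) (p ^+ e).
Proof.
move=> pc; rewrite -[X in p ^+ X]card_ord -prodr_const -[e in (e * _)%N]card_ord.
by rewrite -sum_nat_const; apply: deg_le_prod.
Qed.

Lemma ex_deg_le r (x : 'I_r -> mpoly n k) : exists c, forall i, deg_le c (x i).
Proof.
exists (\max_i mmeasure mdeg (x i))%N => i; apply/deg_leE.
by apply: leqW; exact: (leq_bigmax i).
Qed.

End DegreeBound.

Section GradedSubalgebraDimensions.
Variables (R : realType) (k : fieldType) (n : nat) (G : set (mpoly n k)).
Hypothesis Ghom : forall g, G g -> exists d, g \is ishomog1 d mdeg.
Variable lt : rel (multinom n).
Hypothesis hlt : monomial_order lt.
Local Notation A := (gen_subalg G).
Local Notation sval := (@subalgebra_val k n G).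
Variables (D : nat) (u : 'I_D -> multinom n).
Hypothesis ubasis : mnm_basis (initial_exponents lt A) u.

Lemma subalgebra_lin_indep_le N (T : finType) (a : T -> subalgebra G) :
  (forall t, deg_le N (sval (a t))) -> lin_indep a -> (#|T| <= N.+1 ^ D)%N.
Proof.
move=> aN /lin_indep_val; apply: (subalg_lin_indep_le hlt ubasis) => t.
by split; [exact: subalgebra_valP | apply/deg_leE].
Qed.

Lemma ex_initial_gens : exists a : 'I_D -> subalgebra G,
  forall i, std_grading G (mdeg (u i)) (a i) /\ is_initial lt (sval (a i)) (u i).
Proof.
have [uA _ _] := ubasis.
have /choice [a aP] : forall i, exists a : subalgebra G,
    std_grading G (mdeg (u i)) a /\ is_initial lt (sval a) (u i).
  by move=> i; exact: initial_homog.
by exists a.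
Qed.

(* The box of exponents [0, N]^r gives (N + 1)^r linearly independent elements
   of degree O(N) once denominators are cleared. *)
Lemma trdeg_le_rank : (trdeg R (subalgebra_scalar G) <= D%:R%:E)%E.
Proof.
apply: ge_ereal_sup => _ [r [x xI] <-]; rewrite lee_fin ler_nat leqNgt.
apply/negP => Dr.
have [b b0 [a abx]] := common_denominator x.
have [ca caP] := ex_deg_le (sval \o a).
have [cb cbP] := ex_deg_le (fun _ : 'I_1 => sval b).
(* Each of the [r] factors of [y h] below has degree at most (ca + cb) N; the successor makes [c]
   positive. *)
pose c := ((ca + cb) * r).+1.
have [N] := @expn_gt_growth c D r isT Dr; apply/negP; rewrite -leqNgt.
pose mn (h : {ffun 'I_r -> 'I_N.+1}) : multinom r :=
  Multinom [tuple nat_of_ord (h i) | i < r].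
have mnE h i : mn h i = h i by rewrite mnmE.
have mnI : injective mn.
  move=> h h' /mnmP E; apply/ffunP => i; apply: val_inj.
  by have := E i; rewrite !mnE.
pose y (h : {ffun 'I_r -> 'I_N.+1}) : subalgebra G :=
  \prod_i (a i ^+ h i * b ^+ (N - h i)).
have yE h : tofrac (y h) = tofrac b ^+ (N * r) * mmap1 x (mn h).
  have -> : tofrac b ^+ (N * r) = \prod_(i < r) tofrac b ^+ N.
    by rewrite prodr_const card_ord exprM.
  rewrite /y rmorph_prod -big_split /=; apply: eq_bigr => i _.
  rewrite tofracM !tofracXn -abx exprMn mnE mulrAC -exprD subnKC //.
  exact: leq_ord.
have := @subalgebra_lin_indep_le (c * N) _ y.
rewrite card_ffun !card_ord; apply.
  move=> h; have yN : deg_le (\sum_(i < r) (N * ca + N * cb))%N (sval (y h)).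
    rewrite -[sval _]/(\val _) rmorph_prod; apply: deg_le_prod => i _.
    rewrite rmorphM !rmorphXn; apply: deg_leM.
      by apply: deg_leW (deg_leX (caP i)); rewrite leq_mul2r leq_ord orbT.
    by apply: deg_leW (deg_leX (cbP ord0)); rewrite leq_mul2r leq_subr orbT.
  by apply: deg_leW yN; rewrite sum_nat_const card_ord /c; nia.
move=> l l0 h; pose p := \sum_h l h *: mpolyX k (mn h).
have p0 : p = 0.
  apply: xI; rewrite /p raddf_sum /=.
  have bN0 : tofrac b ^+ (N * r) != 0 by rewrite expf_neq0 // tofrac_eq0.
  apply: (mulfI bN0); rewrite mulr0 mulr_sumr.
  rewrite -[RHS]tofrac0 -l0 rmorph_sum; apply: eq_bigr => h' _ /=.
  rewrite mmapZ mmapX mulrCA -yE -tofracM /=; congr tofrac.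
  by rewrite -scalerAl mul1r.
have := congr1 (mcoeff (mn h)) p0; rewrite mcoeff0 /p raddf_sum /=.
rewrite (bigD1 h) //= mcoeffZ mcoeffX eqxx mulr1 big1 ?addr0 // => h' hh'.
by rewrite mcoeffZ mcoeffX (inj_eq mnI) (negbTE hh') mulr0.
Qed.

Lemma kspan_lin_closed (V : lmodType k) (X : set V) : lin_closed (kspan X).
Proof.
split=> [|c v w [r [a [x [xX ->]]]] [s [b [y [yX ->]]]]].
  by exists 0%N, (fun=> 0), (fun=> 0); split=> [[]|] //; rewrite big_ord0.
exists (r + s)%N,
  (fun i => match fintype.split i with inl j => c * a j | inr j => b j end),
  (fun i => match fintype.split i with inl j => x j | inr j => y j end).
split=> [i|]; first by case: (fintype.split i).
rewrite big_split_ord /= scaler_sumr; congr (_ + _); apply: eq_bigr => i _.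
  by rewrite -[lshift _ _]/(unsplit (inl i)) unsplitK scalerA.
by rewrite -[rshift _ _]/(unsplit (inr i)) unsplitK.
Qed.

Lemma subspace_pow_sum_lin_closed (V : set (subalgebra G)) N :
  lin_closed (subspace_pow_sum V N).
Proof.
split=> [|c _ _ [v vV <-] [w wV <-]].
  exists (fun=> 0); last by rewrite big1.
  by move=> i; have [] := kspan_lin_closed
    [set \prod_(j < i) v j | v in [set v : 'I_i -> subalgebra G | forall j, V (v j)]].
exists (fun i => c *: v i + w i); last by rewrite scaler_sumr big_split.
by move=> i; apply: (kspan_lin_closed _).2; [exact: vV | exact: wV].
Qed.

Lemma subspace_pow_sum_deg (V : set (subalgebra G)) c N a :
  (forall v, V v -> deg_le c (sval v)) ->
  subspace_pow_sum V N a -> deg_le (c * N) (sval a).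
Proof.
move=> Vc [w wV <-]; under eq_bigr do rewrite -[w _]scale1r.
rewrite subalgebra_val_sum; apply: deg_le_sum => i _.
have [r [l [x [xP ->]]]] := wV i.
rewrite subalgebra_val_sum; apply: deg_le_sum => t _.
have [v vV <-] := xP t; rewrite -[sval _]/(\val _) rmorph_prod.
apply: (@deg_leW _ _ (\sum_(j < i) c)); last first.
  by apply: deg_le_prod => j _; exact/Vc/vV.
by rewrite sum_nat_const card_ord mulnC leq_mul2l leq_ord orbT.
Qed.

Lemma subspace_pow_sum_indep_le (V : set (subalgebra G)) c N r
    (v : 'I_r -> subalgebra G) :
  (forall v, V v -> deg_le c (sval v)) ->
  (forall t, subspace_pow_sum V N (v t)) -> lin_indep v ->
  (r <= (c * N).+1 ^ D)%N.
Proof.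
move=> Vc vN vI; rewrite -[r]card_ord.
apply: subalgebra_lin_indep_le vI => t.
exact: subspace_pow_sum_deg (vN t).
Qed.

Lemma span_deg (V : set (subalgebra G)) r (b : 'I_r -> subalgebra G) :
  (forall w, V w -> exists c : 'I_r -> k, w = \sum_i c i *: b i) ->
  exists c, forall v, V v -> deg_le c (sval v).
Proof.
move=> bS; have [c cP] := ex_deg_le (sval \o b).
exists c => v /bS [l ->]; rewrite subalgebra_val_sum.
by apply: deg_le_sum => i _; exact: cP.
Qed.

(** A basis of [V] bounds the degrees in [V] by some [c], hence those of products of at most [N]
    elements by c N. *)
Lemma GKdim_le_rank : (GKdim R (subalgebra G) <= D%:R%:E)%E.
Proof.
apply: ge_ereal_sup => _ [V [_ [r [b [_ bS _]]]] <-].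
have [c cP] := span_deg bS.
apply: (@limn_esup_ln_le R _ c) => N; apply: vdim_le => s v.
exact: subspace_pow_sum_indep_le.
Qed.

(** The span of elements with initial exponents [u] attains the bound: distinct monomials in these
    elements have distinct initial exponents. *)
Lemma GKdim_ge_rank : (D%:R%:E <= GKdim R (subalgebra G))%E.
Proof.
have [a aP] := ex_initial_gens; have [_ uf _] := ubasis.
pose V : set (subalgebra G) :=
  [set v | exists c : 'I_D -> k, v = \sum_i c i *: a i].
have Vlin : lin_closed V.
  split=> [|c _ _ [l ->] [l' ->]].
    by exists (fun=> 0); rewrite big1 // => i _; rewrite scale0r.
  exists (fun i => c * l i + l' i); rewrite scaler_sumr -big_split /=.
  by apply: eq_bigr => i _; rewrite scalerDl scalerA.
have Va i : V (a i).
  exists (fun j => (j == i)%:R); rewrite (bigD1 i) //= eqxx scale1r big1 ?addr0 //.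
  by move=> j /negbTE ->; rewrite scale0r.
have [r Vr] : exists r, has_dim V r.
  apply: (@lin_closed_has_dim _ _ _ D) Vlin _ => r v vV vI.
  by rewrite -[r]card_ord; apply: (lin_indep_le_span (b := a)) vI.
have Vfd : fd_subspace V.
  split; last by exists r.
  split=> [|c v w]; rewrite !inE; first by case: Vlin.
  by move=> Vv Vw; apply: Vlin.2.
apply: le_trans (ereal_sup_ubound _); last by exists V.
(* With exponents up to [N %/ D.+1], a monomial in the [D] elements has total degree at most [N];
   [D.+1] is positive even if [D = 0]. *)
apply: (@limn_esup_ln_ge R _ D.+1) => // N.
have [b [_ bS _]] := Vr; have [c cP] := span_deg bS.
have [s Ns] : exists s, has_dim (subspace_pow_sum V N) s.
  apply: (lin_closed_has_dim (B := ((c * N).+1 ^ D)%N)).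
    exact: subspace_pow_sum_lin_closed.
  by move=> s v; exact: subspace_pow_sum_indep_le.
rewrite (has_dim_vdim Ns); set M := (N %/ D.+1)%N.
pose mn (h : {ffun 'I_D -> 'I_M.+1}) : multinom D :=
  Multinom [tuple nat_of_ord (h i) | i < D].
have mnE h i : mn h i = h i by rewrite mnmE.
have mnI : injective mn.
  move=> h h' /mnmP E; apply/ffunP => i; apply: val_inj.
  by have := E i; rewrite !mnE.
have := @has_dim_vdim_indep _ _ _ _ (fun h => mmap1 a (mn h)) _ Ns.
rewrite card_ffun !card_ord; apply; last first.
  apply/lin_indep_val.
  apply: (@initial_lin_indep _ _ _ hlt _ _ (fun h => mnm_comb u (mn h))).
    by move=> h h' /(mnm_comb_inj uf)/mnI.
  move=> h; rewrite -[sval _]/(\val _) rmorph_prod.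
  rewrite (eq_bigr (fun i => sval (a i) ^+ mn h i)); last first.
    by move=> i _; rewrite rmorphXn.
  by apply: (is_initial_mmap1 hlt) => i; case: (aP i).
move=> h.
pose P i (x : subalgebra G) :=
  exists2 v : 'I_i -> subalgebra G, (forall j, V (v j)) & \prod_j v j = x.
have PM i j x y : P i x -> P j y -> P (i + j)%N (x * y).
  move=> [v vV <-] [w wV <-].
  exists (fun l => match fintype.split l with inl l => v l | inr l => w l end).
    by move=> l; case: (fintype.split l).
  rewrite big_split_ord /=; congr (_ * _); apply: eq_bigr => l _.
    by rewrite -[lshift _ _]/(unsplit (inl l)) unsplitK.
  by rewrite -[rshift _ _]/(unsplit (inr l)) unsplitK.
have P0 : P 0%N 1 by exists (fun=> 0) => [[]//|]; rewrite big_ord0.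
have Pmn : P (mdeg (mn h)) (mmap1 a (mn h)).
  rewrite mdegE /mmap1; elim/big_ind2: _ => // [i x j y|i _]; first exact: PM.
  elim: (mn h i) => [|e IH]; first by rewrite expr0.
  rewrite exprS -add1n; apply: PM IH.
  by exists (fun=> a i) => //; rewrite big_ord1.
have mnN : (mdeg (mn h) < N.+1)%N.
  rewrite ltnS mdegE (@leq_trans (\sum_(i < D) M)%N) //.
    by apply: leq_sum => i _; rewrite mnE leq_ord.
  rewrite sum_nat_const card_ord mulnC /M.
  by apply: leq_trans (leq_trunc_div N D.+1); rewrite leq_mul2l leqnSn orbT.
(* A product of [mdeg (mn h)] elements of [V] goes into the summand of that index. *)
exists (fun i : 'I_N.+1 => if i == Ordinal mnN then mmap1 a (mn h) else 0); last first.
  by rewrite -big_mkcond big_pred1_eq.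
move=> i; case: eqP => [->|_] /=; last by have [] := kspan_lin_closed
  [set \prod_(j < i) v j | v in [set v : 'I_i -> subalgebra G | forall j, V (v j)]].
exists 1%N, (fun=> 1), (fun=> mmap1 a (mn h)); split; last first.
  by rewrite big_ord1 scale1r.
by move=> _; case: Pmn => v vV vE; exists v.
Qed.

End GradedSubalgebraDimensions.

(** * Non-roots in extensions; extending independent families *)

Section NonRoots.
Variable k : fieldType.

Lemma ex_irreducible_factor (p : {poly k}) : (1 < size p)%N ->
  exists2 q, irreducible_poly q & q %| p.
Proof.
have [m] := ubnP (size p); elim: m p => // m IH p /ltnSE pm p1.
have [pirr|pred] := pselect (irreducible_poly p); first by exists p.
have [q [q1 qp nqp]] : exists q : {poly k}, [/\ size q != 1%N, q %| p & ~~ (q %= p)].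
  apply: contrapT => N; apply: pred; split=> // q q1 qp.
  by apply/negPn/negP => nqp; apply: N; exists q.
have p0 : p != 0 by rewrite -size_poly_gt0 ltnW.
have q0 : q != 0 by apply: dvdpN0 qp p0.
have qltp : (size q < size p)%N.
  rewrite ltn_neqAle dvdp_leq // andbT; apply: contra nqp => /eqP sqp.
  by rewrite -dvdp_size_eqp // sqp.
have q2 : (1 < size q)%N by rewrite ltn_neqAle eq_sym q1 size_poly_gt0.
have [s sirr sq] := IH q (leq_trans qltp pm) q2.
by exists s => //; exact: dvdp_trans sq qp.
Qed.

(* Over a finite [k] a nonzero polynomial may vanish on all of [k]; a root of
   [1 + X p] in an extension is never a root of [p]. *)
Lemma ex_ext_nonroot (p : {poly k}) : p != 0 ->
  exists (L : fieldExtType k) (z : L), (map_poly (in_alg L) p).[z] != 0.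
Proof.
move=> p0; pose q := 1 + 'X * p.
have q1 : (1 < size q)%N.
  have sXp : (1 < size ('X * p)%R)%N by rewrite mulrC size_mulX // ltnS size_poly_gt0.
  by rewrite /q addrC size_polyDl // size_poly1.
have [s sirr sq] := ex_irreducible_factor q1.
have [L _ [z zs _]] := irredp_FAdjoin sirr.
exists L, z; apply/negP => /eqP pz.
have : root (map_poly (in_alg L) q) z.
  by case/dvdpP: sq => t ->; rewrite rmorphM rootM zs orbT.
rewrite rmorphD rmorphM /= map_polyX rmorph1 rootE hornerD hornerM pz mulr0.
by rewrite addr0 hornerC oner_eq0.
Qed.

End NonRoots.

Section LinearIndependenceExtension.
Variables (F : fieldType) (V : lmodType F).

Lemma lin_indep_rcons r (v : nat -> V) :
  lin_indep (fun i : 'I_r => v i) ->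
  (forall c : 'I_r -> F, v r <> \sum_i c i *: v i) ->
  lin_indep (fun i : 'I_r.+1 => v i).
Proof.
move=> vI vr c; rewrite big_ord_recr /= => c0.
have cr : c ord_max = 0.
  apply/eqP/negPn/negP => cr.
  apply: (vr (fun i => - (c ord_max)^-1 * c (widen_ord (leqnSn r) i))).
  under eq_bigr do rewrite -scalerA.
  rewrite -scaler_sumr scaleNr -scalerN; apply: (scalerI cr).
  rewrite scalerA divff // scale1r; apply/eqP; rewrite -addr_eq0 addrC.
  exact/eqP.
move: c0; rewrite cr scale0r addr0 => /vI ci i.
have [j ->|->//] := unliftP ord_max i.
by rewrite -[RHS](ci j); congr c; apply: val_inj; rewrite /= /bump leqNgt ltn_ord.
Qed.

Lemma lin_indep_mx r d (v : 'I_r -> 'rV[F]_d) :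
  lin_indep v -> row_free (\matrix_i v i).
Proof.
move=> vI; apply: inj_row_free => c c0; apply/rowP => i; rewrite mxE.
apply: (vI (fun i => c 0 i)); rewrite -[RHS]c0 mulmx_sum_row.
by apply: eq_bigr => j _; rewrite rowK.
Qed.

End LinearIndependenceExtension.

(** * Homogeneous primes as kernels of specialisations *)

Section GradedPrimes.
Variables (k : fieldType) (n : nat) (G : set (mpoly n k)).
Hypothesis Ghom : forall g, G g -> exists d, g \is ishomog1 d mdeg.
Local Notation A := (gen_subalg G).
Local Notation sval := (@subalgebra_val k n G).

(* The kernel on [A] of the graded map [x_i |-> c_i X] into [B[X]]; the maps
   need not be injective on degrees, hence the quantification over them. *)
Definition spec_prime (B : comNzRingType) (iota : {rmorphism k -> B})
    (c : 'I_n -> B) : set (subalgebra G) :=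
  [set a | forall e, mmap iota c (pihomog mdeg e (sval a)) = 0].

(** This identifies [spec_prime] with the kernel of a ring morphism into [B[X]], which makes it
    prime when [B] is a domain. *)
Lemma coef_mmap_scaleX (B : comNzRingType) (iota : {rmorphism k -> B})
    (c : 'I_n -> B) (p : mpoly n k) e :
  (mmap (polyC \o iota) (fun i => c i *: 'X) p)`_e =
  mmap iota c (pihomog mdeg e p).
Proof.
have E m : mmap1 (fun i => c i *: 'X) m = mmap1 c m *: 'X^(mdeg m).
  rewrite mdegE /mmap1; elim/big_rec3: _ => [|i x d y _ ->].
    by rewrite expr0 alg_polyC.
  by rewrite exprZn exprD -scalerAl -scalerAr scalerA.
rewrite [in LHS]/mmap coef_sum pihomogE raddf_sum [RHS]big_mkcond /=.
apply: eq_bigr => m _; rewrite E mmapZ mmapX coefCM coefZ coefXn eq_sym.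
by case: eqP; rewrite ?mulr1 ?mulr0.
Qed.

Lemma spec_primeP (B : comNzRingType) (iota : {rmorphism k -> B})
    (c : 'I_n -> B) a : spec_prime iota c a <->
  mmap (polyC \o iota) (fun i => c i *: 'X) (sval a) = 0.
Proof.
split=> [ca|ca e]; last by rewrite -coef_mmap_scaleX ca coef0.
by apply/polyP => e; rewrite coef_mmap_scaleX ca coef0.
Qed.

Lemma spec_prime_prime (B : idomainType) (iota : {rmorphism k -> B})
    (c : 'I_n -> B) : prime_ideal (spec_prime iota c).
Proof.
pose phi a := mmap (polyC \o iota) (fun i => c i *: 'X) (sval a).
have phiD a b : phi (a + b) = phi a + phi b by exact: (rmorphD (mmap _ _)).
have phiM a b : phi (a * b) = phi a * phi b by exact: (rmorphM (mmap _ _)).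
apply/prime_idealP; split.
- by apply/spec_primeP; exact: (rmorph0 (mmap _ _)).
- move/spec_primeP => /eqP; rewrite [mmap _ _ _](rmorph1 (mmap _ _)).
  by rewrite oner_eq0.
- move=> a b /spec_primeP a0 /spec_primeP b0; apply/spec_primeP.
  by rewrite -/(phi _) phiD /phi a0 b0 addr0.
- move=> a b /spec_primeP b0; apply/spec_primeP.
  by rewrite -/(phi _) phiM /phi b0 mulr0.
- move=> a b /spec_primeP /eqP; rewrite -/(phi _) phiM mulf_eq0.
  by case/orP => /eqP ab0; [left|right]; apply/spec_primeP.
Qed.

Lemma pihomog_pihomog d e (p : mpoly n k) : pihomog mdeg e (pihomog mdeg d p) =
  if d == e then pihomog mdeg d p else 0.
Proof.
have [->|de] := eqVneq d e; first by rewrite pihomog_id.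
by rewrite (pihomog_ne0 de) // pihomogP.
Qed.

Lemma spec_prime_homog (B : comNzRingType) (iota : {rmorphism k -> B})
    (c : 'I_n -> B) : homogeneous_ideal (std_grading G) (spec_prime iota c).
Proof.
move=> a ca; set s := mmeasure mdeg (sval a).
exists s, (fun e : 'I_s => Subalgebra
  (pihomog_gen_subalg Ghom e (subalgebra_valP a))), (fun e => e).
split=> [e|]; first split.
- move=> d /=; rewrite pihomog_pihomog; case: ifP => _; first exact: ca.
  exact: (rmorph0 (mmap _ _)).
- exact: pihomogP.
apply: (@val_inj _ _ (subalgebra G)); rewrite raddf_sum /=.
exact: pihomog_partitionE.
Qed.

Lemma spec_prime_sub (B B' : comNzRingType) (iota : {rmorphism k -> B})
    (iota' : {rmorphism k -> B'}) (c : 'I_n -> B) (c' : 'I_n -> B')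
    (sigma : {rmorphism B -> B'}) :
  (forall x, sigma (iota x) = iota' x) -> (forall i, sigma (c i) = c' i) ->
  spec_prime iota c `<=` spec_prime iota' c'.
Proof.
move=> si sc a ca e; rewrite -[RHS](rmorph0 sigma) -(ca e) rmorph_mmap.
apply: eq_bigr => m _ /=; rewrite si; congr (_ * _).
by apply: eq_bigr => i _ /=; rewrite sc.
Qed.

Lemma spec_prime_homogE (B : comNzRingType) (iota : {rmorphism k -> B})
    (c : 'I_n -> B) e a : std_grading G e a ->
  (spec_prime iota c a <-> mmap iota c (sval a) = 0).
Proof.
move=> ae; split=> [/(_ e)|a0 d]; first by rewrite pihomog_dE.
have [<-|ed] := eqVneq e d; first by rewrite pihomog_dE.
by rewrite (pihomog_ne0 ed) // (rmorph0 (mmap _ _)).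
Qed.

(* There are more monomials of degree [r N] in the [x i] than equations
   [La a = 0]; a combination of them solving the equations is not mapped to 0,
   as their images have distinct initial exponents. *)
Lemma homog_relation n' (lt : rel (multinom n')) (c : 'I_n -> mpoly n' k)
    (r e N q : nat) (x : 'I_r.+1 -> subalgebra G)
    (w : 'I_r.+1 -> multinom n') (La : mpoly n k -> 'I_q -> k) :
  monomial_order lt ->
  (forall i, std_grading G e (x i)) ->
  (forall i, is_initial lt (mmap (@mpolyC n' k) c (sval (x i))) (w i)) ->
  (forall a b : multinom r.+1, mdeg a = mdeg b ->
     mnm_comb w a = mnm_comb w b -> a = b) ->
  (forall (T : finType) (l : T -> k) (y : T -> mpoly n k) i,
     La (\sum_t l t *: y t) i = \sum_t l t * La (y t) i) ->
  (q < N.+1 ^ r)%N ->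
  exists a, [/\ std_grading G (e * (r * N)) a, forall i, La (sval a) i = 0
              & mmap (@mpolyC n' k) c (sval a) != 0].
Proof.
move=> hlt xe xw winj Lalin qN.
(* The last exponent pads the degree to r N. The products are then homogeneous of one degree, and
   [winj], which compares only monomials of equal degree, applies. *)
pose mn (h : {ffun 'I_r -> 'I_N.+1}) : multinom r.+1 :=
  Multinom [tuple if unlift ord_max i is Some j then nat_of_ord (h j)
                  else (r * N - \sum_j h j)%N | i < r.+1].
have mnE h j : mn h (lift ord_max j) = h j by rewrite mnmE liftK.
have mnmax h : mn h ord_max = (r * N - \sum_j h j)%N by rewrite mnmE unlift_none.
have mnI : injective mn.
  move=> h h' /mnmP E; apply/ffunP => i; apply: val_inj.
  by have := E (lift ord_max i); rewrite !mnE.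
have mndeg h : mdeg (mn h) = (r * N)%N.
  rewrite mdegE (bigD1_ord ord_max) //= mnmax.
  rewrite [X in (_ + X)%N](eq_bigr (fun j => nat_of_ord (h j))); last first.
    by move=> j _; exact: mnE.
  rewrite subnK // -[X in (_ <= X * _)%N]card_ord -sum_nat_const.
  by apply: leq_sum => i _; exact: leq_ord.
pose y h := mmap1 x (mn h).
have yE h : sval (y h) = mmap1 (sval \o x) (mn h).
  rewrite -[LHS]/(\val _) rmorph_prod; apply: eq_bigr => i _.
  by rewrite rmorphXn.
have [|l [h lh] l0] := @lin_relation k {ffun 'I_r -> 'I_N.+1} q
  (fun h i => La (sval (y h)) i); first by rewrite card_ffun !card_ord.
exists (\sum_h l h *: y h); split.
- rewrite /std_grading /= subalgebra_val_sum.
  apply: rpred_sum => h' _; apply: rpredZ; rewrite yE -(mndeg h') mdegE big_distrr /=.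
  rewrite /mmap1; elim/big_ind2: _ => [|d p d' p' pd pd'|i _].
  + exact: dhomog1.
  + exact: dhomogM.
  + by apply: dhomogMn; exact: xe.
- by move=> i; rewrite subalgebra_val_sum Lalin.
have evI : lin_indep (fun h => mmap (@mpolyC n' k) c (sval (y h))).
  apply: (@initial_lin_indep _ _ _ hlt _ _ (fun h => mnm_comb w (mn h))).
    by move=> h1 h2 /winj; rewrite !mndeg => /(_ erefl) /mnI.
  move=> h'; rewrite yE rmorph_prod /=.
  rewrite (eq_bigr (fun i => mmap (@mpolyC n' k) c (sval (x i)) ^+ mn h' i)).
    exact: is_initial_mmap1.
  by move=> i _; rewrite rmorphXn.
apply/eqP => a0; move: lh; rewrite (evI l) ?eqxx // -[RHS]a0.
rewrite subalgebra_val_sum rmorph_sum; apply: eq_bigr => h' _ /=.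
by rewrite mmapZ mul_mpolyC.
Qed.

End GradedPrimes.

(** * Weights and toric maps *)

Section Weights.
Variables (n e : nat).

Definition dom_weight (j : 'I_n) : nat := (e.+1 ^ (n - j) * e.+1)%N.

Definition wdeg (v : multinom n) : nat := (\sum_j dom_weight j * v j)%N.

(* In base [e + 1] the exponents of a monomial of degree [e] are digits, so
   among these monomials [wdeg] refines the lexicographic order. *)
Lemma wdeg_gap (v w : multinom n) : mdeg v = e -> mdeg w = e -> (v < w)%O ->
  (wdeg v + e < wdeg w)%N.
Proof.
move=> ve we /(ltmcP (etrans ve (esym we))) [i veq vi].
rewrite /wdeg (bigID (fun j : 'I_n => (j < i)%N)) /=.
rewrite [X in (_ < X)%N](bigID (fun j : 'I_n => (j < i)%N)) /=.
rewrite (eq_bigr (fun j => dom_weight j * w j)%N) => [|j ji]; last by rewrite veq.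
rewrite -addnA ltn_add2l (bigD1 i) ?ltnn //= [X in (_ < X)%N](bigD1 i) ?ltnn //=.
rewrite -addnA -addnS.
apply: (@leq_trans (dom_weight i * (v i).+1)%N); last first.
  by apply: leq_trans (leq_addr _ _); rewrite leq_mul2l vi orbT.
rewrite mulnS addnC leq_add2r.
(* Past position [i] every weight is at most (e + 1)^(n - i - 1) (e + 1), and the exponents of [v]
   there add up to at most [e]. *)
apply: (@leq_trans (e.+1 ^ (n - i.+1) * e.+1 * e + e.+1)%N).
  rewrite addnS ltnS leq_add2r -[X in (_ <= _ * X)%N]ve mdegE big_distrr /=.
  rewrite [X in (_ <= X)%N](bigID (fun j : 'I_n => ~~ (j < i)%N && (j != i))) /=.
  apply: leq_trans (leq_addr _ _); apply: leq_sum => j /andP[ji jni].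
  rewrite leq_mul2r leq_mul2r leq_pexp2l ?orbT // leq_sub2l //.
  by rewrite ltn_neqAle eq_sym jni leqNgt.
rewrite /dom_weight -(subnSK (ltn_ord i)); set b := (n - i.+1)%N.
rewrite expnSr [X in (_ <= X)%N]mulnS addnC leq_add2r.
by rewrite leq_pmull // expn_gt0.
Qed.

End Weights.

Section ToricMap.
Variables (k : fieldType) (n n' : nat) (t : 'I_n -> multinom n').

Lemma mmap1_mpolyX (v : multinom n) :
  mmap1 (fun i => mpolyX k (t i)) v = mpolyX k (mnm_comb t v).
Proof.
rewrite /mmap1 /mnm_comb.
elim/big_rec2: _ => [|i x y _ ->]; first by rewrite mpolyX0.
by rewrite mpolyXD mpolyXn.
Qed.

Lemma mmap_mpolyX (p : mpoly n k) :
  mmap (@mpolyC n' k) (fun i => mpolyX k (t i)) p =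
  \sum_(v <- msupp p) mcoeff v p *: mpolyX k (mnm_comb t v).
Proof.
by apply: eq_bigr => v _; rewrite mmap1_mpolyX mul_mpolyC.
Qed.

Lemma msupp_mmap_mpolyX (p : mpoly n k) w :
  w \in msupp (mmap (@mpolyC n' k) (fun i => mpolyX k (t i)) p) ->
  exists2 v, v \in msupp p & w = mnm_comb t v.
Proof.
rewrite mmap_mpolyX mcoeff_msupp raddf_sum /= => w0.
apply: contrapT => N; move: w0; rewrite big1_seq ?eqxx // => v /= vp.
rewrite mcoeffZ mcoeffX; case: eqP => [vw|]; rewrite ?mulr0 //.
by case: N; exists v.
Qed.

Lemma is_initial_toric (lt' : rel (multinom n')) (p : mpoly n k) w :
  irreflexive lt' -> w \in msupp p ->
  (forall v, v \in msupp p -> v != w -> lt' (mnm_comb t v) (mnm_comb t w)) ->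
  is_initial lt' (mmap (@mpolyC n' k) (fun i => mpolyX k (t i)) p) (mnm_comb t w).
Proof.
move=> lt_irr wp wmax; split=> [|_ /msupp_mmap_mpolyX [v vp ->] vw]; last first.
  by apply: wmax => //; apply: contraNneq vw => ->.
rewrite mcoeff_msupp mmap_mpolyX raddf_sum (big_rem w) //= mcoeffZ mcoeffX eqxx.
rewrite mulr1 big1_seq ?addr0 -?mcoeff_msupp // => v /=.
rewrite mem_rem_uniq ?msupp_uniq // inE => /andP[vw vp].
rewrite mcoeffZ mcoeffX; case: eqP => [E|]; rewrite ?mulr0 //.
by have := wmax v vp vw; rewrite E lt_irr.
Qed.

End ToricMap.

Section ColumnSelection.
Variables (n D e : nat) (v : 'I_D -> multinom n).
Hypothesis vfree : row_free (mnm_mx v).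
Hypothesis vdeg : forall i, mdeg (v i) = e.

(* The row of ones stands for the degree; the others list the exponents of the
   images under [tor] of monomials with exponents [v]. *)
Definition col_row (s : nat -> 'I_n) (i : nat) : 'rV[rat]_D :=
  match i with
  | 0 => \row_l 1
  | 1 => \row_l (wdeg e (v l))%:R
  | i.+2 => \row_l (v l (s i))%:R
  end.

Lemma eq_col_row s s' l : (forall i, (i < l)%N -> s i = s' i) ->
  forall i : 'I_l.+2, col_row s i = col_row s' i.
Proof. by move=> ss' [[|[|i]] il] //=; rewrite ss'. Qed.

Lemma eq_lin_indep_col_row s s' l : (forall i, (i < l)%N -> s i = s' i) ->
  lin_indep (fun i : 'I_l.+2 => col_row s i) ->
  lin_indep (fun i : 'I_l.+2 => col_row s' i).
Proof. by move=> /eq_col_row /funext ->. Qed.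

(** Two distinct monomials of degree [e] have different [wdeg], so the weight row is not a multiple
    of the row of ones. *)
Lemma col_row_base s : (1 < D)%N -> lin_indep (fun i : 'I_2 => col_row s i).
Proof.
move=> D1 c; rewrite !big_ord_recl big_ord0 addr0 /= => c0.
pose i0 := Ordinal (ltnW D1); pose i1 := Ordinal D1.
have vinj : injective v.
  move=> i j vij.
  have := @row_free_inj _ 1 _ _ _ vfree (delta_mx 0 i) (delta_mx 0 j).
  rewrite /= -!rowE => H.
  have /H /matrixP /(_ 0 i) : row i (mnm_mx v) = row j (mnm_mx v).
    by apply/rowP => l; rewrite !mxE vij.
  by rewrite !mxE !eqxx /=; case: eqP => // <-.
have wdeg01 : wdeg e (v i0) != wdeg e (v i1).
  have : v i0 != v i1 by rewrite (inj_eq vinj).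
  rewrite neq_lt => /orP[] /(wdeg_gap (vdeg _) (vdeg _)) H.
    by rewrite ltn_eqF // (leq_ltn_trans _ H) // leq_addr.
  by rewrite gtn_eqF // (leq_ltn_trans _ H) // leq_addr.
have E i : c ord0 + c (lift ord0 ord0) * (wdeg e (v i))%:R = 0.
  by have /rowP /(_ i) := c0; rewrite !mxE mulr1.
have : c (lift ord0 ord0) * ((wdeg e (v i0))%:R - (wdeg e (v i1))%:R) = 0.
  by rewrite mulrBr -[X in X - _](addKr (c ord0)) E -[X in _ - X](addKr (c ord0)) E subrr.
move=> /eqP; rewrite mulf_eq0 subr_eq0 eqr_nat (negbTE wdeg01) orbF => /eqP c1.
have c00 : c ord0 = 0 by have := E i0; rewrite c1 mul0r addr0.
by move=> i; case: (unliftP ord0 i) => [j ->|->//]; rewrite ord1.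
Qed.

(** The exponent rows are the columns of a matrix of rank [D] and span the whole space; fewer than
    [D] rows cannot contain all of them in their span. *)
Lemma col_row_step s l : (l.+2 < D)%N ->
  lin_indep (fun i : 'I_l.+2 => col_row s i) ->
  exists j, lin_indep (fun i : 'I_l.+3 =>
    col_row (fun i => if (i < l)%N then s i else j) i).
Proof.
move=> lD sI; apply: contrapT => N.
have span j : exists c : 'I_l.+2 -> rat,
    \row_l (v l j)%:R = \sum_i c i *: col_row s i.
  apply: contrapT => Nj; apply: N; exists j.
  apply: lin_indep_rcons; first by apply: eq_lin_indep_col_row sI => i ->.
  move=> c; rewrite /= ltnn => E; apply: Nj; exists c; rewrite E.
  apply: eq_bigr => i _; congr (_ *: _).
  by apply: eq_col_row => a ->.
have [d dP] := choice span.
have /row_fullP [B BU] : row_full (mnm_mx v)^T by rewrite /row_full mxrank_tr.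
have deltaI : lin_indep (fun i : 'I_D => delta_mx 0 i : 'rV[rat]_D).
  move=> c /rowP c0 i; have := c0 i; rewrite summxE (bigD1 i) //= !mxE !eqxx mulr1.
  rewrite big1 ?addr0 // => j ji; rewrite !mxE eqxx [i == j]eq_sym (negbTE ji).
  by rewrite mulr0.
have := @lin_indep_le_span _ _ _ _ _ (fun i : 'I_l.+2 => col_row s i) _ deltaI.
rewrite card_ord => H; move: lD; rewrite ltnNge => /negP; apply; apply: H => i.
exists (fun a => \sum_j B i j * d j a).
have -> : delta_mx 0 i = \sum_j B i j *: \row_l (v l j)%:R :> 'rV[rat]_D.
  rewrite -row1 -BU row_mul mulmx_sum_row; apply: eq_bigr => j _.
  by rewrite mxE; congr (_ *: _); apply/rowP => a; rewrite !mxE.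
under eq_bigr do rewrite dP scaler_sumr.
rewrite exchange_big; apply: eq_bigr => a _; rewrite scaler_suml.
by apply: eq_bigr => j _; rewrite scalerA.
Qed.

Lemma ex_col_rows : (1 < D)%N -> exists s, forall l, (l.+2 <= D)%N ->
  lin_indep (fun i : 'I_l.+2 => col_row s i).
Proof.
move=> D1.
have n0 : (0 < n)%N.
  by apply: leq_trans (rank_leq_col (mnm_mx v)); rewrite (eqP vfree) ltnW.
suff H m : (m.+2 <= D)%N -> exists s, forall l, (l <= m)%N ->
    lin_indep (fun i : 'I_l.+2 => col_row s i).
  have [|s sP] := H D.-2; first by case: (D) D1 => [|[]].
  exists s => l lD; apply: sP.
  by case: (D) lD => [|[|d]].
elim: m => [_|m IH mD].
  by exists (fun=> Ordinal n0) => l; rewrite leqn0 => /eqP ->; exact: col_row_base.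
have [s sP] := IH (ltnW mD).
have [j jP] := col_row_step mD (sP m (leqnn m)).
exists (fun i => if (i < m)%N then s i else j) => l.
rewrite leq_eqVlt => /orP[/eqP ->//|lm].
apply: eq_lin_indep_col_row (sP l lm) => i il.
by rewrite (leq_trans il lm).
Qed.

(** Independent rows have an invertible maximal minor; [f] selects its columns, that is, [l.+2] of
    the monomials [v]. *)
Lemma ex_col_select s l : lin_indep (fun i : 'I_l.+2 => col_row s i) ->
  exists f : 'I_l.+2 -> 'I_D, forall x : 'I_l.+2 -> rat,
    (forall i : 'I_l.+2, \sum_t col_row s i 0 (f t) * x t = 0) ->
    forall t, x t = 0.
Proof.
move=> /lin_indep_mx; set M := \matrix_i _ => Mfree.
have fM : row_full M^T by rewrite /row_full mxrank_tr.
exists (fullrankfun fM) => x x0 t.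
have := fullrowsub_free fM; set N := rowsub _ _ => Nfree.
have := @row_free_inj _ 1 _ _ _ Nfree (\row_t x t) 0.
rewrite mul0mx => H; have /H /rowP /(_ t) : (\row_t x t) *m N = 0.
  apply/rowP => i; rewrite !mxE -[RHS](x0 i); apply: eq_bigr => a _.
  by rewrite !mxE mulrC.
by rewrite !mxE.
Qed.

(* x_i |-> y_0^(dom_weight i) y_i if [J i], and x_i |-> y_0^(dom_weight i)
   otherwise. *)
Definition tor (J : pred 'I_n) (i : 'I_n) : multinom n.+1 :=
  Multinom [tuple if unlift ord0 a is Some j then nat_of_bool (J j && (i == j))
                  else dom_weight e i | a < n.+1].

Lemma tor0 J w : mnm_comb (tor J) w ord0 = wdeg e w.
Proof.
by rewrite mnm_combE; apply: eq_bigr => i _; rewrite mnmE unlift_none.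
Qed.

Lemma torS J w j : mnm_comb (tor J) w (lift ord0 j) = if J j then w j else 0%N.
Proof.
rewrite mnm_combE (bigD1 j) //= mnmE liftK eqxx andbT big1 => [|i /negbTE ij].
  by rewrite addn0; case: (J j); rewrite ?mul1n ?mul0n.
by rewrite mnmE liftK ij andbF mul0n.
Qed.

(** The image of a monomial [a] has degree between [wdeg e a] and [wdeg e a + e], so the gap in
    [wdeg_gap] makes the image of [w] the one of largest degree, whatever [J] is. *)
Lemma tor_initial (k : fieldType) J (p : mpoly n k) w :
  p \is ishomog1 e mdeg ->
  is_initial (fun a b : multinom n => (a < b)%O) p w ->
  is_initial (fun a b : multinom n.+1 => (a < b)%O)
    (mmap (@mpolyC n.+1 k) (fun i => mpolyX k (tor J i)) p)
    (mnm_comb (tor J) w).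
Proof.
move=> /dhomog_mf pe [wp wmax]; apply: is_initial_toric => [a|//|a ap aw].
  exact: ltxx.
apply: lt_mdeg_ltmc.
have := wdeg_gap (pe _ ap) (pe _ wp) (wmax _ ap aw).
rewrite !mdegE !big_ord_recl /= !tor0 => gap.
apply: leq_trans (leq_addr _ _); apply: leq_trans gap.
have ae : mdeg a = e := pe _ ap.
rewrite ltnS leq_add2l -[X in (_ <= X)%N]ae mdegE; apply: leq_sum => j _.
by rewrite torS; case: (J j).
Qed.

Definition prefix_pred (s : nat -> 'I_n) l : pred 'I_n :=
  fun j => j \in [seq s i | i <- iota 0 l].

(** Equal degrees, equal exponents of y_0 and equal exponents of the variables in the prefix are the
    equations given by the rows of [col_row], applied to the difference of [a] and [b]. *)
Lemma tor_affine_inj s l : lin_indep (fun i : 'I_l.+2 => col_row s i) ->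
  exists f : 'I_l.+2 -> 'I_D, forall a b : multinom l.+2, mdeg a = mdeg b ->
    mnm_comb (fun i => mnm_comb (tor (prefix_pred s l)) (v (f i))) a =
    mnm_comb (fun i => mnm_comb (tor (prefix_pred s l)) (v (f i))) b -> a = b.
Proof.
move=> /ex_col_select [f fP]; exists f => a b ab.
move=> /mnmP E; apply/mnmP => t; apply/eqP; rewrite -(eqr_nat rat) -subr_eq0.
apply/eqP; move: t; apply: fP => -[[|[|i]] il] /=.
- under eq_bigr do rewrite mxE mul1r.
  by rewrite sumrB -!natr_sum -!mdegE ab subrr.
- have := E ord0; rewrite !mnm_combE => /(congr1 (fun m : nat => m%:R : rat)).
  rewrite !natr_sum => /eqP; rewrite -subr_eq0 -sumrB => /eqP E0.
  rewrite -[RHS]E0; apply: eq_bigr => t _.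
  by rewrite mxE tor0 !natrM mulrBr.
- have si : prefix_pred s l (s i).
    by apply: map_f; rewrite mem_iota; move: il; rewrite !ltnS.
  have := E (lift ord0 (s i)); rewrite !mnm_combE => /(congr1 (fun m : nat => m%:R : rat)).
  rewrite !natr_sum => /eqP; rewrite -subr_eq0 -sumrB => /eqP E0.
  rewrite -[RHS]E0; apply: eq_bigr => t _.
  by rewrite mxE torS si !natrM mulrBr.
Qed.

End ColumnSelection.

(** * The chain of homogeneous primes *)

Section GradedChain.
Variables (k : fieldType) (n : nat) (G : set (mpoly n k)).
Hypothesis Ghom : forall g, G g -> exists d, g \is ishomog1 d mdeg.
Local Notation A := (gen_subalg G).
Local Notation sval := (@subalgebra_val k n G).
Local Notation dlex m := (fun a b : multinom m => (a < b)%O).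

(** Raising each generator to the product of the degrees of the others equalises the degrees and
    merely scales the rows of the exponent matrix by positive factors. *)
Lemma ex_equidegree_gens D (u : 'I_D -> multinom n) :
  mnm_basis (initial_exponents (dlex n) A) u ->
  exists e (x : 'I_D -> subalgebra G) (v : 'I_D -> multinom n),
    [/\ (0 < e)%N, forall i, std_grading G e (x i),
        forall i, is_initial (dlex n) (sval (x i)) (v i)
      & row_free (mnm_mx v)].
Proof.
move=> uB; have [a aP] := ex_initial_gens Ghom uB; have [_ uf _] := uB.
have u0 i : (0 < mdeg (u i))%N.
  rewrite lt0n mdeg_eq0; apply/eqP => ui.
  have := @row_free_inj _ 1 _ _ _ uf (delta_mx 0 i) 0; rewrite mul0mx -rowE => H.
  have /H /matrixP /(_ 0 i) : row i (mnm_mx u) = 0.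
    by apply/rowP => j; rewrite !mxE ui mnm0E.
  by rewrite !mxE !eqxx => /eqP; rewrite oner_eq0.
pose c i := (\prod_(j | j != i) mdeg (u j))%N.
have c0 i : (0 < c i)%N by apply: prodn_cond_gt0.
exists (\prod_i mdeg (u i))%N, (fun i => a i ^+ c i), (fun i => mnm_muln (u i) (c i)).
split=> [|i|i|].
- exact: prodn_gt0.
- rewrite (bigD1 i) //= -/(c i) /std_grading /= -[sval _]/(\val _) rmorphXn.
  by apply: dhomogMn; case: (aP i).
- rewrite -[sval _]/(\val _) rmorphXn.
  by apply: (is_initialX (mnmc_monomial_order n)); case: (aP i).
apply: inj_row_free => r r0.
have := @row_free_inj _ 1 _ _ _ uf (\row_i (r 0 i * (c i)%:R)) 0.
rewrite mul0mx => H; have /H /rowP E : (\row_i (r 0 i * (c i)%:R)) *m mnm_mx u = 0.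
  rewrite -[RHS]r0; apply/rowP => j; rewrite !mxE; apply: eq_bigr => i _.
  by rewrite !mxE mulmnE natrM -mulrA [(c i)%:R * _]mulrC.
apply/rowP => i; have := E i; rewrite !mxE => /eqP; rewrite mulf_eq0 pnatr_eq0.
by rewrite eqn0Ngt c0 orbF => /eqP.
Qed.

Variables (e D : nat) (x : 'I_D -> subalgebra G) (v : 'I_D -> multinom n).
Hypotheses (e0 : (0 < e)%N) (xe : forall i, std_grading G e (x i)).
Hypothesis xv : forall i, is_initial (dlex n) (sval (x i)) (v i).
Hypothesis vfree : row_free (mnm_mx v).

Lemma initial_deg i : mdeg (v i) = e.
Proof. by have /dhomog_mf := xe i; apply; case: (xv i). Qed.

Definition tor_prime (s : nat -> 'I_n) l : set (subalgebra G) :=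
  spec_prime (@mpolyC n.+1 k) (fun i => mpolyX k (tor e (prefix_pred s l) i)).

Lemma prefix_predS (s : nat -> 'I_n) l j : prefix_pred s l j -> prefix_pred s l.+1 j.
Proof.
rewrite /prefix_pred => /mapP [i]; rewrite mem_iota => il ->.
by apply: map_f; rewrite mem_iota; lia.
Qed.

(** Setting the variables outside the shorter prefix to 1 turns the longer toric map into the
    shorter one. *)
Lemma tor_prime_sub s l : tor_prime s l.+1 `<=` tor_prime s l.
Proof.
pose y (a : 'I_n.+1) : mpoly n.+1 k := if unlift ord0 a is Some j then
  (if prefix_pred s l j then mpolyX k (mnm1 a) else 1) else mpolyX k (mnm1 a).
apply: (@spec_prime_sub _ _ _ _ _ _ _ _ _ (mmap (@mpolyC n.+1 k) y)) => [c|i].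
  exact: mmapC.
rewrite [LHS]mmapX mpolyXE_id; apply: eq_bigr => a _; rewrite /y !mnmE.
case: (unliftP ord0 a) => [j _|//].
case: (boolP (prefix_pred s l j)) => [/prefix_predS -> //|_].
by rewrite expr1n expr0.
Qed.

Lemma tor_prime_strict s l : (l.+3 <= D)%N ->
  lin_indep (fun i : 'I_l.+3 => col_row e v s i) ->
  exists a, tor_prime s l a /\ ~ tor_prime s l.+1 a.
Proof.
move=> lD sI.
have [f finj] := tor_affine_inj sI.
set J := prefix_pred s l; set J' := prefix_pred s l.+1 in finj *.
(* In degree e (l + 2) N the exponent of y_0 is at most that degree times the sum of the weights;
   the successor leaves room for the exponents of the other variables. Hence all are at most C N. *)
pose C := ((\sum_(j < n) dom_weight e j).+1 * (e * l.+2))%N.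
have C0 : (0 < C)%N by rewrite !muln_gt0 e0.
have [N NP] := expn_gt_growth C0 (ltnSn l.+1).
set M := (C * N)%N in NP.
(* All monomials that can occur in the image: [h ord0] is the exponent of y_0, and that of a
   variable in [J] is stored at one plus its first position in the prefix. *)
pose mon (h : {ffun 'I_l.+1 -> 'I_M.+1}) : multinom n.+1 :=
  Multinom [tuple if unlift ord0 a is Some j then
      (if J j then nat_of_ord (h (inord (index j [seq s i | i <- iota 0 l]).+1)) else 0%N)
    else nat_of_ord (h ord0) | a < n.+1].
pose ev p := mmap (@mpolyC n.+1 k) (fun i => mpolyX k (tor e J i)) p.
pose q := #|{: {ffun 'I_l.+1 -> 'I_M.+1}}|.
have [||||a [ae a0 a1]] := @homog_relation k n G n.+1 (dlex n.+1)
  (fun i => mpolyX k (tor e J' i)) l.+2 e N q (x \o f) _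
  (fun p i => mcoeff (mon (enum_val i)) (ev p)) (mnmc_monomial_order _) _ _ finj.
- by move=> i; exact: xe.
- by move=> i; apply: tor_initial (xv _); exact: xe.
- move=> T c y i.
  have -> : ev (\sum_t c t *: y t) = \sum_t c t *: ev (y t).
    rewrite /ev rmorph_sum; apply: eq_bigr => t _.
    by rewrite [LHS]mmapZ mul_mpolyC.
  by rewrite raddf_sum; apply: eq_bigr => t _; rewrite /= mcoeffZ.
- by rewrite /q card_ffun !card_ord.
exists a; split; last by move=> /(spec_prime_homogE _ _ ae) /eqP; rewrite (negbTE a1).
apply/(spec_prime_homogE _ _ ae)/mpolyP => m; rewrite mcoeff0.
have [mp|/memN_msupp_eq0 //] := boolP (m \in msupp (ev (sval a))).
have [w wp mw] := msupp_mmap_mpolyX mp.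
have wdeg_le : mdeg w = (e * (l.+2 * N))%N by have /dhomog_mf := ae; apply.
have wC j : (w j <= e * (l.+2 * N))%N.
  by rewrite -wdeg_le mdegE (bigD1 j) //= leq_addr.
have EM : (e * (l.+2 * N) <= M)%N by rewrite /M /C; nia.
pose h : {ffun 'I_l.+1 -> 'I_M.+1} := [ffun t : 'I_l.+1 =>
  inord (if unlift ord0 t is Some i then w (s i) else wdeg e w)].
have -> : m = mon h.
  rewrite mw; apply/mnmP => b; case: (unliftP ord0 b) => [j ->|->].
    rewrite torS mnmE liftK; case: ifP => // Jj.
    have jl : (index j [seq s i | i <- iota 0 l] < l)%N.
      by move: Jj; rewrite /J /prefix_pred -index_mem size_map size_iota.
    rewrite ffunE; set t : 'I_l.+1 := inord _.+1.
    have -> : t = lift ord0 (Ordinal jl) by apply: val_inj; rewrite /t /= inordK // ltnS.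
    rewrite liftK inordK /=.
      have := nth_index j Jj; rewrite (nth_map 0%N) ?size_iota // nth_iota //.
      by rewrite add0n => ->.
    by rewrite ltnS; apply: leq_trans EM.
  rewrite tor0 mnmE unlift_none ffunE unlift_none inordK // ltnS.
  apply: (@leq_trans (\sum_(j < n) dom_weight e j * (e * (l.+2 * N)))%N).
    by apply: leq_sum => j _; rewrite leq_mul2l wC orbT.
  by rewrite -big_distrl /= /M /C !mulnA leq_mul2r leq_mul2r leq_mul2r leqnSn !orbT.
by have := a0 (enum_rank h); rewrite enum_rankK.
Qed.

(** The specialisation y_0 = z, applied after all other variables have been set to 1. *)
Definition zeta_prime (L : fieldExtType k) (z : L) : set (subalgebra G) :=
  spec_prime (in_alg L) (fun i => z ^+ dom_weight e i).

Definition irrelevant_prime : set (subalgebra G) :=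
  spec_prime (@idfun k) (fun=> 0).

Lemma tor_prime_sub_zeta s (L : fieldExtType k) (z : L) :
  tor_prime s 0 `<=` zeta_prime z.
Proof.
pose y (a : 'I_n.+1) : L := if unlift ord0 a is Some _ then 1 else z.
apply: (@spec_prime_sub _ _ _ _ _ _ _ _ _ (mmap (in_alg L) y)) => [c|i].
  exact: mmapC.
rewrite [LHS]mmapX /mmap1 big_ord_recl /y unlift_none mnmE unlift_none big1.
  by rewrite mulr1.
by move=> j _; rewrite liftK expr1n.
Qed.

(** In each degree the image in [L] has dimension at most q = [L : k], but two generators have q + 1
    products of degree q with independent images under the toric map. *)
Lemma tor_prime_strict_zeta s (L : fieldExtType k) (z : L) :
  lin_indep (fun i : 'I_2 => col_row e v s i) ->
  exists a, zeta_prime z a /\ ~ tor_prime s 0 a.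
Proof.
move=> sI; have [f finj] := tor_affine_inj sI.
pose ev (p : mpoly n k) := mmap (in_alg L) (fun i => z ^+ dom_weight e i) p.
pose q := \dim {:L}.
have [||||a [ae a0 a1]] := @homog_relation k n G n.+1 (dlex n.+1)
  (fun i => mpolyX k (tor e (prefix_pred s 0) i)) 1 e q q (x \o f) _
  (fun p i => coord (vbasis {:L}) i (ev p)) (mnmc_monomial_order _) _ _ finj.
- by move=> i; exact: xe.
- by move=> i; apply: tor_initial (xv _); exact: xe.
- move=> T c y i.
  have -> : ev (\sum_t c t *: y t) = \sum_t c t *: ev (y t).
    rewrite /ev raddf_sum; apply: eq_bigr => t _.
    by rewrite [LHS]mmapZ /= mulr_algl.
  by rewrite raddf_sum; apply: eq_bigr => t _; rewrite /= linearZ.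
- by rewrite expn1.
exists a; split; last by move=> /(spec_prime_homogE _ _ ae) /eqP; rewrite (negbTE a1).
apply/(spec_prime_homogE _ _ ae); rewrite -/(ev _).
rewrite (coord_vbasis (memvf (ev (sval a)))) big1 // => i _.
by rewrite a0 scale0r.
Qed.

Lemma irrelevant_mcoeff (p : mpoly n k) : mmap idfun (fun=> 0 : k) p = mcoeff mnm0 p.
Proof.
have E m : mmap1 (fun _ : 'I_n => 0 : k) m = (m == mnm0)%:R.
  case: eqP => [->|/eqP m0]; first exact: mmap11.
  have [i mi] : exists i, m i != 0%N.
    apply: contrapT => N; move/eqP: m0; apply; apply/mnmP => i; rewrite mnm0E.
    by apply/eqP/negPn/negP => mi; apply: N; exists i.
  by rewrite /mmap1 (bigD1 i) //= expr0n (negbTE mi) mul0r.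
rewrite [in RHS](mpolyE p) raddf_sum; apply: eq_bigr => m _.
by rewrite /= mcoeffZ mcoeffX E.
Qed.

Lemma zeta_prime_sub (L : fieldExtType k) (z : L) :
  zeta_prime z `<=` irrelevant_prime.
Proof.
move=> a za d; rewrite irrelevant_mcoeff mcoeff_pihomog mdeg0.
case: eqP => // _; have := za 0%N.
have -> : pihomog mdeg 0 (sval a) = mpolyC n (mcoeff mnm0 (sval a)).
  apply/mpolyP => m; rewrite mcoeff_pihomog mcoeffC mdeg_eq0.
  by case: eqP => [->|_]; rewrite ?mulr1 ?mulr0.
by rewrite mmapC => /eqP; rewrite fmorph_eq0 => /eqP.
Qed.

Lemma irrelevant_prime_gen i : irrelevant_prime (x i).
Proof.
apply/(spec_prime_homogE _ _ (xe i)).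
rewrite irrelevant_mcoeff memN_msupp_eq0 //; apply/negP.
move=> /(dhomog_mf (xe i)) m0e; have : mdeg (mnm0 : multinom n) = e by [].
by rewrite mdeg0 => e00; move: e0; rewrite -e00.
Qed.

(** Under x_j |-> X^(dom_weight j) the initial monomial of [x i] has strictly the largest degree, so
    the image is a nonzero polynomial, and [z] is taken as a non-root. *)
Lemma ex_zeta i : exists (L : fieldExtType k) (z : L), ~ zeta_prime z (x i).
Proof.
pose al := mmap (@polyC k) (fun j => 'X^(dom_weight e j)) (sval (x i)).
have E m : mmap1 (fun j : 'I_n => 'X^(dom_weight e j) : {poly k}) m = 'X^(wdeg e m).
  rewrite /mmap1 /wdeg; elim/big_rec2: _ => [|j d p _ ->]; first by rewrite expr0.
  by rewrite exprD exprM.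
have [vx vmax] := xv i.
have al0 : al != 0.
  apply/eqP => al0; move: (vx); rewrite mcoeff_msupp => /negP; apply.
  have := congr1 (fun p : {poly k} => p`_(wdeg e (v i))) al0; rewrite coef0.
  rewrite /al /mmap coef_sum (big_rem (v i)) //= E coefCM coefXn eqxx mulr1.
  rewrite big1_seq ?addr0; first by move=> /eqP.
  move=> m /=; rewrite mem_rem_uniq ?msupp_uniq // inE => /andP[mv mp].
  rewrite E coefCM coefXn.
  have := wdeg_gap (dhomog_mf (xe i) mp) (initial_deg i) (vmax _ mp mv).
  move=> /(leq_ltn_trans (leq_addr _ _)) /ltn_eqF; rewrite eq_sym => ->.
  by rewrite mulr0.
have [L [z zP]] := ex_ext_nonroot al0; exists L, z.
move=> /(spec_prime_homogE _ _ (xe i)) x0; move/eqP: zP; apply.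
rewrite -[RHS]x0 -[LHS]/(horner_eval z (map_poly (in_alg L) al)) /al.
rewrite !rmorph_mmap; apply: eq_bigr => m _ /=.
rewrite /horner_eval map_polyC hornerC; congr (_ * _); apply: eq_bigr => j _ /=.
by rewrite /horner_eval map_polyXn hornerXn.
Qed.

Lemma gr_krull_dim_ge_gens (R : realType) :
  (D%:R%:E <= gr_krull_dim R (std_grading G))%E.
Proof.
apply: ereal_sup_ubound; exists D => //.
have goodP (B : idomainType) (iota : {rmorphism k -> B}) (c : 'I_n -> B) :
    prime_ideal (spec_prime iota c : set (subalgebra G)) /\
    homogeneous_ideal (std_grading G) (spec_prime iota c).
  by split; [exact: spec_prime_prime | exact: spec_prime_homog].
have [D0|Dpos] := posnP D.
  by exists (fun=> irrelevant_prime); rewrite D0; split=> // i _; exact: goodP.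
have [D1|D2] := leqP D 1.
  have DE : D = 1%N by apply/eqP; rewrite eqn_leq D1.
  pose zero : set (subalgebra G) :=
    spec_prime (@mpolyC n k) (fun i => mpolyX k (mnm1 i)).
  exists (fun i => if i is 0 then zero else irrelevant_prime).
  rewrite DE; split=> [[|i] _|[] // _]; first exact: goodP.
    exact: goodP.
  have mmap_id (p : mpoly n k) :
      mmap (@mpolyC n k) (fun i => mpolyX k (mnm1 i)) p = p.
    rewrite [RHS]mpolyE; apply: eq_bigr => m _.
    by rewrite mmap1_id mul_mpolyC.
  have x0 := irrelevant_prime_gen (Ordinal Dpos).
  split=> [a za d|/(_ _ x0) /(spec_prime_homogE _ _ (xe _))].
    by have := za d; rewrite mmap_id => ->; exact: (rmorph0 (mmap _ _)).
  rewrite mmap_id => x00; have [] := xv (Ordinal Dpos).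
  by rewrite x00 msupp0.
have [s sP] := ex_col_rows vfree initial_deg D2.
have [L [z zx]] := ex_zeta (Ordinal Dpos).
(* The D - 1 toric primes, with ever shorter prefixes, are followed by the specialised one at D - 1
   and the irrelevant ideal at D. *)
exists (fun i => if (i <= D - 2)%N then tor_prime s (D - 2 - i)
                 else if i == D.-1 then zeta_prime z else irrelevant_prime).
split=> [i _|i iD]; first by case: ifP => _; [|case: ifP => _]; exact: goodP.
have [iD2|iD2] := ltnP i (D - 2).
  rewrite (ltnW iD2); have -> : (D - 2 - i = (D - 2 - i.+1).+1)%N by lia.
  split; first exact: tor_prime_sub.
  have lD : ((D - 2 - i.+1).+3 <= D)%N by lia.
  have [a [a1 a2]] := tor_prime_strict lD (sP _ lD).
  by move=> /(_ _ a1).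
move: iD2; rewrite leq_eqVlt => /orP[/eqP iE|iD2].
  have -> : (i <= D - 2)%N by rewrite iE.
  have -> : i.+1 == D.-1 by apply/eqP; lia.
  have -> : (D - 2 - i = 0)%N by lia.
  split; first exact: tor_prime_sub_zeta.
  have [a [a1 a2]] := tor_prime_strict_zeta z (sP 0%N D2).
  by move=> /(_ _ a1).
have -> : (i <= D - 2)%N = false by lia.
have -> : i == D.-1 by apply/eqP; lia.
have -> : i.+1 == D.-1 = false by apply/eqP; lia.
split; first exact: zeta_prime_sub.
by move=> /(_ _ (irrelevant_prime_gen (Ordinal Dpos))).
Qed.

End GradedChain.

Lemma gr_krull_dim_ge_rank (R : realType) (k : fieldType) n (G : set (mpoly n k))
    D (u : 'I_D -> multinom n) :
  (forall g, G g -> exists d, g \is ishomog1 d mdeg) ->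
  mnm_basis (initial_exponents (fun a b => (a < b)%O) (gen_subalg G)) u ->
  (D%:R%:E <= gr_krull_dim R (std_grading G))%E.
Proof.
move=> Ghom uB; have [e [x [v [e0 xe xv vf]]]] := ex_equidegree_gens Ghom uB.
exact: gr_krull_dim_ge_gens e0 xe xv vf R.
Qed.

(** * Rational generating series *)

Section RationalSequences.
Variable V : zmodType.
Implicit Types (h : nat -> V) (ws : seq nat).

Definition shift j h : nat -> V := fun d => if (j <= d)%N then h (d - j)%N else 0.

(* On generating series: multiplication by [1 - t^w]. *)
Definition delta w h : nat -> V := h \- shift w h.

(** The generating series becomes a polynomial after multiplication by all factors 1 - t^w with w in
    [ws]. *)
Definition rational_seq ws h : Prop :=
  exists N, forall d, (N <= d)%N -> foldl (fun h w => delta w h) h ws d = 0.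

Lemma shift_shift i j h : shift i (shift j h) = shift (i + j) h.
Proof.
apply/funext => d; rewrite /shift.
have [id|di] := leqP i d; last by rewrite leqNgt ltn_addr.
by rewrite leq_subRL // subnDA.
Qed.

Lemma shift0 h : shift 0 h = h.
Proof. by apply/funext => d; rewrite /shift subn0. Qed.

Lemma shiftD j h h' : shift j (h \+ h') = shift j h \+ shift j h'.
Proof. by apply/funext => d; rewrite /shift /=; case: leqP; rewrite ?addr0. Qed.

Lemma shiftB j h h' : shift j (h \- h') = shift j h \- shift j h'.
Proof. by apply/funext => d; rewrite /shift /=; case: leqP; rewrite ?subr0. Qed.

Lemma deltaD w h h' : delta w (h \+ h') = delta w h \+ delta w h'.
Proof. by apply/funext => d; rewrite /delta shiftD /= opprD addrACA. Qed.

Lemma deltaB w h h' : delta w (h \- h') = delta w h \- delta w h'.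
Proof.
by apply/funext => d; rewrite /delta shiftB /= !opprD !opprK addrACA.
Qed.

Lemma delta_shift w j h : delta w (shift j h) = shift j (delta w h).
Proof. by rewrite /delta shiftB !shift_shift addnC. Qed.

Lemma rational_seqD ws h h' : rational_seq ws h -> rational_seq ws h' ->
  rational_seq ws (h \+ h').
Proof.
elim: ws h h' => [|w ws IH] h h'; last first.
  move=> hr h'r; have := IH (delta w h) (delta w h') hr h'r.
  by rewrite -deltaD.
move=> [N /= hN] [M /= h'M]; exists (maxn N M) => d; rewrite geq_max => /andP[Nd Md].
by rewrite /= hN // h'M // addr0.
Qed.

Lemma rational_seqB ws h h' : rational_seq ws h -> rational_seq ws h' ->
  rational_seq ws (h \- h').
Proof.
elim: ws h h' => [|w ws IH] h h'; last first.
  move=> hr h'r; have := IH (delta w h) (delta w h') hr h'r.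
  by rewrite -deltaB.
move=> [N /= hN] [M /= h'M]; exists (maxn N M) => d; rewrite geq_max => /andP[Nd Md].
by rewrite /= hN // h'M // subr0.
Qed.

Lemma rational_seq_shift ws j h : rational_seq ws h -> rational_seq ws (shift j h).
Proof.
elim: ws h => [|w ws IH] h; last first.
  by move=> hr; have := IH (delta w h) hr; rewrite -delta_shift.
move=> [N /= hN]; exists (N + j)%N => d Nd /=.
rewrite /shift (leq_trans (leq_addl _ _) Nd) hN // leq_subRL 1?addnC //.
exact: leq_trans (leq_addl _ _) Nd.
Qed.

Lemma rational_seq0 ws : rational_seq ws (fun=> 0).
Proof.
elim: ws => [|w ws [N IH]]; first by exists 0%N.
exists N => d Nd /=; rewrite -[RHS](IH d Nd); congr (foldl _ _ _ _).
by apply/funext => d'; rewrite /delta /shift /= if_same subr0.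
Qed.

Lemma rational_seq_sum ws K (h : nat -> nat -> V) :
  (forall j, (j < K)%N -> rational_seq ws (h j)) ->
  rational_seq ws (fun d => \sum_(j < K) h j d).
Proof.
elim: K => [|K IH] hr.
  have -> : (fun d => \sum_(j < 0) h j d) = (fun=> 0).
    by apply/funext => d; rewrite big_ord0.
  exact: rational_seq0.
have -> : (fun d => \sum_(j < K.+1) h j d) = (fun d => \sum_(j < K) h j d) \+ h K.
  by apply/funext => d; rewrite big_ord_recr.
apply: rational_seqD; last exact: hr.
by apply: IH => j jK; apply: hr; exact: ltnW.
Qed.

End RationalSequences.

(** * Dickson's lemma and counting in down-closed sets *)

Section Dickson.

(** Each next index is one where [u] takes its minimum over the remaining tail. *)
Lemma monotone_subsequence (u : nat -> nat) : exists phi : nat -> nat,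
  {homo phi : i j / (i < j)%N} /\ {homo (u \o phi) : i j / (i <= j)%N}.
Proof.
have /choice [g gP] : forall N, exists i, (N <= i)%N /\
    forall j, (N <= j)%N -> (u i <= u j)%N.
  move=> N; pose P x := `[< exists2 i, (N <= i)%N & u i = x >].
  have exP : exists x, P x by exists (u N); apply/asboolP; exists N.
  have [x /asboolP [i Ni <-] xmin] := ex_minnP exP.
  by exists i; split=> // j Nj; apply: xmin; apply/asboolP; exists j.
pose phi i := iter i (fun a => g a.+1) (g 0%N).
have phi_lt : {homo phi : i j / (i < j)%N}.
  apply: homo_ltn; first exact: ltn_trans.
  by move=> i; rewrite /phi iterS; case: (gP (phi i).+1).
exists phi; split=> // i j; rewrite leq_eqVlt => /orP[/eqP -> //|ij] /=.
case: i ij => [|i] ij; first by apply: (gP 0%N).2.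
by apply: (gP _).2; exact: (phi_lt i j (ltnW ij)).
Qed.

Lemma dickson m (a : nat -> seq nat) : (forall i, size (a i) = m) ->
  exists2 phi : nat -> nat, {homo phi : i j / (i < j)%N}
    & forall i j, (i <= j)%N -> all2 leq (a (phi i)) (a (phi j)).
Proof.
elim: m a => [|m IH] a sa.
  by exists id => // i j _; rewrite (size0nil (sa i)) (size0nil (sa j)).
have [phi [phi_lt phi_le]] := monotone_subsequence (fun i => head 0%N (a i)).
have [|psi psi_lt psi_le] := IH (fun i => behead (a (phi i))).
  by move=> i; rewrite size_behead sa.
exists (phi \o psi) => [i j ij|i j ij]; first exact/phi_lt/psi_lt.
have psi_mono : (psi i <= psi j)%N.
  by move: ij; rewrite leq_eqVlt => /orP[/eqP ->//|/psi_lt/ltnW].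
have := psi_le i j ij; have := phi_le _ _ psi_mono => /=.
have := sa (phi (psi i)); have := sa (phi (psi j)).
by case: (a (phi (psi i))) (a (phi (psi j))) => [|x s] [|y t] //= _ _ -> ->.
Qed.

(** Otherwise infinitely many vectors are lost one after another. By Dickson's lemma some vector
    lost earlier lies below one still present later, against closure under smaller vectors. *)
Lemma descending_stable m (P : nat -> seq nat -> Prop) :
  (forall j s t, size s = m -> size t = m -> all2 leq s t -> P j t -> P j s) ->
  (forall i j s, size s = m -> (i <= j)%N -> P j s -> P i s) ->
  exists J, forall j s, size s = m -> (J <= j)%N -> P J s -> P j s.
Proof.
move=> Pdown Pdesc; apply: contrapT => N.
have /choice [g gP] : forall J, exists js : nat * seq nat,
    [/\ size js.2 = m, (J <= js.1)%N, P J js.2 & ~ P js.1 js.2].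
  move=> J; apply: contrapT => NJ; apply: N; exists J => j s sm Jj PJ.
  by apply: contrapT => Pj; apply: NJ; exists (j, s).
pose J i := iter i (fun a => (g a).1) 0%N.
have J_le : {homo J : i j / (i <= j)%N}.
  apply: homo_leq; [exact: leqnn|exact: leq_trans|] => i.
  by rewrite /J iterS; case: (gP (J i)).
have [|phi phi_lt phi_le] := @dickson m (fun i => (g (J i)).2).
  by move=> i; case: (gP (J i)).
have [s0 _ P0 nP0] := gP (J (phi 0%N)); have [s1 _ P1 _] := gP (J (phi 1%N)).
apply: nP0; apply: (Pdown _ _ _ s0 s1 (phi_le 0%N 1%N isT)).
by apply: Pdesc P1 => //; exact: (J_le _ _ (phi_lt 0%N 1%N isT)).
Qed.

End Dickson.

Section CountDownSets.

(** The exponent vectors of weight [d]; for positive weights no exponent exceeds [d], so the range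
    of [j] loses none. *)
Fixpoint wexp (ws : seq nat) (d : nat) : seq (seq nat) :=
  if ws is w :: ws' then
    flatten [seq [seq j :: s | s <- wexp ws' (d - j * w)]
            | j <- iota 0 d.+1 & (j * w <= d)%N]
  else if d is 0 then [:: [::]] else [::].

Lemma wexp_cons w ws d : wexp (w :: ws) d =
  flatten [seq [seq j :: s | s <- wexp ws (d - j * w)]
          | j <- iota 0 d.+1 & (j * w <= d)%N].
Proof. by []. Qed.

Lemma mem_wexp ws d s : all (leq 1) ws ->
  s \in wexp ws d = (size s == size ws) && (sumn [seq x.1 * x.2 | x <- zip s ws]%N == d).
Proof.
elim: ws d s => [|w ws IH] d s; first by case: s d => [|x s] [|d].
rewrite wexp_cons [all _ _]/= => /andP[w0 ws0].
apply/flattenP/idP => [[t /mapP [j]]|].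
  rewrite mem_filter => /andP[jd _] -> /mapP [s' + ->].
  by rewrite IH //= eqSS => /andP[-> /eqP ->]; rewrite /= subnKC.
case: s => [|j s] //=; rewrite eqSS => /andP[ss /eqP sd].
have jd : j \in [seq j <- iota 0 d.+1 | (j * w <= d)%N].
  rewrite mem_filter mem_iota -sd leq_addr /= add0n ltnS.
  by apply: leq_trans (leq_addr _ _); rewrite leq_pmulr.
exists [seq j :: s | s <- wexp ws (d - j * w)].
  exact: (map_f (fun j => [seq j :: s | s <- wexp ws (d - j * w)]) jd).
by apply: map_f; rewrite IH // ss /= -sd addKn.
Qed.

Lemma uniq_wexp ws d : uniq (wexp ws d).
Proof.
elim: ws d => [|w ws IH] d; first by case: d.
rewrite wexp_cons; have := filter_uniq (fun j => (j * w <= d)%N) (iota_uniq 0 d.+1).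
elim: [seq j <- _ | _] => //= j js IHj /andP[jjs /IHj ujs].
rewrite cat_uniq ujs andbT map_inj_uniq ?IH => [|s t []//].
apply/hasPn => s /flattenP [t /mapP [i ijs ->] /mapP [s' _ ->]].
by apply/mapP => -[t' _ [ij _]]; rewrite -ij ijs in jjs.
Qed.

Definition wcount ws (P : pred (seq nat)) d : nat := count P (wexp ws d).

Variable V : nzRingType.

Lemma wcount_cons w ws P d K : (0 < w)%N -> (d < K)%N ->
  (wcount (w :: ws) P d)%:R =
  \sum_(j < K) shift (j * w) (fun d => (wcount ws (fun s => P (nat_of_ord j :: s)) d)%:R : V) d.
Proof.
move=> w0 dK; rewrite /wcount wexp_cons count_flatten -map_comp sumnE big_map big_filter.
rewrite natr_sum -[iota 0 d.+1]/(index_iota 0 d.+1) big_mkcond.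
rewrite -(big_mkord xpredT (fun j => shift (j * w) (fun d =>
  (count (fun s => P (j :: s)) (wexp ws d))%:R : V) d)) /=.
rewrite [RHS](big_cat_nat (n := d.+1)) //= [X in _ + X]big1_seq ?addr0.
  apply: eq_bigr => j _; rewrite /shift; case: ifP => // jd.
  by rewrite /= count_map.
move=> j /andP[_]; rewrite mem_index_iota => /andP[dj _]; rewrite /shift.
by rewrite leqNgt (leq_trans dj) // leq_pmulr.
Qed.

Definition down_closed m (P : pred (seq nat)) : Prop :=
  forall s t, size s = m -> size t = m -> all2 leq s t -> P t -> P s.

Lemma all2_leq_refl s : all2 leq s s.
Proof. by elim: s => //= j s ->; rewrite leqnn. Qed.

(* The slices [s |-> P (j :: s)] decrease with [j] and stabilise, so that only
   finitely many of their differences contribute to the telescoped sum. *)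
Lemma rational_wcount ws (P : pred (seq nat)) : all (leq 1) ws ->
  down_closed (size ws) P -> rational_seq ws (fun d => (wcount ws P d)%:R : V).
Proof.
elim: ws P => [|w ws IH] P /=.
  by move=> _ _; exists 1%N => -[|d] //= _; rewrite /wcount /= mulr0n.
move=> /andP[w0 ws0] Pdown.
pose Q j : pred (seq nat) := fun s => P (j :: s).
pose h j d : V := (wcount ws (Q j) d)%:R.
have Qdown j : down_closed (size ws) (Q j).
  move=> s t ss st st_le; apply: Pdown; rewrite /= ?ss ?st //.
  by rewrite leqnn.
have Qdesc i j s : size s = size ws -> (i <= j)%N -> Q j s -> Q i s.
  move=> ss ij; apply: Pdown; rewrite /= ?ss // ij.
  exact: all2_leq_refl.
have [J Jstable] := descending_stable Qdown Qdesc.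
have hJ j : (J <= j)%N -> h j = h J.
  move=> Jj; apply/funext => d; rewrite /h /wcount; congr (_%:R).
  apply: eq_in_count => s; rewrite mem_wexp // => /andP[/eqP ss _].
  by apply/idP/idP => [/(Qdesc _ _ _ ss Jj)//|/(Jstable _ _ ss Jj)].
have hr j : rational_seq ws (h j) by apply: IH.
rewrite -[rational_seq _ _]/(rational_seq ws (delta w _)).
have -> : delta w (fun d => (wcount (w :: ws) P d)%:R) =
    h 0%N \+ (fun d => \sum_(j < J) shift (j.+1 * w) (h j.+1 \- h j) d).
  (* Past [d] the shifted terms vanish and past [J] the slices agree, so [K] bounds the sum and
     allows splitting it at [J]. *)
  apply/funext => d; pose K := maxn d J.
  have dK : (d < K.+1)%N by rewrite ltnS leq_maxl.
  have shiftH : shift w (fun d => (wcount (w :: ws) P d)%:R) d =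
      \sum_(j < K.+1) shift (j.+1 * w) (h j) d.
    under eq_bigr do rewrite mulSn -shift_shift.
    rewrite /shift; case: leqP => wd; last by rewrite big1.
    by rewrite (@wcount_cons w ws P (d - w) K.+1) // (leq_ltn_trans (leq_subr _ _)).
  rewrite /delta /= shiftH (@wcount_cons w ws P d K.+1) //.
  rewrite big_ord_recl big_ord_recr /= mul0n shift0 -addrA; congr (_ + _).
  rewrite [X in _ - (_ + X)](_ : _ = 0); last first.
    by rewrite /shift leqNgt (leq_trans dK) // leq_pmulr.
  rewrite addr0 -sumrB -(big_mkord xpredT (fun j =>
    shift (j.+1 * w) (h j.+1) d - shift (j.+1 * w) (h j) d)).
  rewrite (big_cat_nat (n := J)) ?leq_maxr //= [X in _ + X]big1_seq ?addr0.
    by rewrite big_mkord; apply: eq_bigr => j _; rewrite shiftB.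
  move=> j /andP[_]; rewrite mem_index_iota => /andP[Jj _].
  by rewrite (hJ j) // (hJ j.+1) ?subrr // leqW.
apply: rational_seqD => //.
apply: (@rational_seq_sum _ _ _ (fun j => shift (j.+1 * w) (h j.+1 \- h j))) => j _.
by apply/rational_seq_shift/rational_seqB.
Qed.

End CountDownSets.

Section KSpan.
Variables (k : fieldType) (V : lmodType k).

Lemma kspan_min (X W : set V) : lin_closed W -> X `<=` W -> kspan X `<=` W.
Proof.
move=> Wlin XW v [r [c [x [xX ->]]]]; apply: lin_closed_sum => // t _.
exact/XW/xX.
Qed.

Lemma kspan_gen (X : set V) : X `<=` kspan X.
Proof.
move=> x Xx; exists 1%N, (fun=> 1), (fun=> x); split=> //.
by rewrite big_ord1 scale1r.
Qed.

End KSpan.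

(** * Standard monomials and the Hilbert function *)

Section StandardMonomials.
Variables (k : fieldType) (n m : nat) (G : set (mpoly n k)).
Local Notation sval := (@subalgebra_val k n G).
Variables (a : 'I_m -> subalgebra G) (w : 'I_m -> nat).
Hypotheses (w0 : forall i, (0 < w i)%N) (aw : forall i, std_grading G (w i) (a i)).
Local Notation fm := (mmap1 a).
Hypothesis agen : forall b : subalgebra G, kspan (range fm) b.
Implicit Types (x y z : multinom m).

Definition wt x : nat := (\sum_i x i * w i)%N.

Definition lower_span x : set (subalgebra G) :=
  kspan [set fm y | y in [set y | wt y = wt x /\ (y < x)%O]].

(* The exponents that are not initial for the ideal of relations among the
   generators [a]. *)
Definition standard x : Prop := ~ lower_span x (fm x).

Lemma wtD x y : wt (mnm_add x y) = (wt x + wt y)%N.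
Proof. by rewrite /wt -big_split; apply: eq_bigr => i _; rewrite mnmDE mulnDl. Qed.

Lemma mmap1D x y : fm (mnm_add x y) = fm x * fm y.
Proof.
by rewrite /mmap1 -big_split; apply: eq_bigr => i _; rewrite mnmDE exprD.
Qed.

Lemma std_grading_mmap1 x : std_grading G (wt x) (fm x).
Proof.
rewrite /std_grading /= -[sval _]/(\val _) rmorph_prod /wt.
elim/big_ind2: _ => [|d p d' p' pd pd'|i _].
- exact: dhomog1.
- exact: dhomogM.
- by rewrite rmorphXn mulnC; apply: dhomogMn; exact: aw.
Qed.

Lemma std_grading_kspan d b : std_grading G d b ->
  kspan [set fm x | x in [set x | wt x = d]] b.
Proof.
move=> bd; have [r [c [v [vP bE]]]] := agen b.
have /choice [x xP] : forall t, exists x, fm x = v t.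
  by move=> t; have [x _ <-] := vP t; exists x.
suff -> : b = \sum_(t | wt (x t) == d) c t *: v t.
  apply: lin_closed_sum; first exact: kspan_lin_closed.
  by move=> t /eqP td; apply: kspan_gen; exists (x t).
apply: (@val_inj _ _ (subalgebra G)); rewrite -[LHS](pihomog_dE bd).
rewrite [in LHS]bE /= !subalgebra_val_sum raddf_sum [RHS]big_mkcond.
apply: eq_bigr => t _; rewrite -xP /= linearZ /=.
have xd := std_grading_mmap1 (x t).
have [<-|dt] := eqVneq (wt (x t)) d; first by rewrite pihomog_dE.
by rewrite (pihomog_ne0 dt) // scaler0.
Qed.

(** An expression of [x] by smaller monomials of the same weight, multiplied by the monomial y - x,
    is one for [y]. *)
Lemma standard_down x y : (forall i, (x i <= y i)%N) -> standard y -> standard x.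
Proof.
move=> xy ystd xl; apply: ystd.
pose z := mnm_sub y x.
have yE : mnm_add x z = y.
  by apply/mnmP => i; rewrite mnmDE mnmBE subnKC.
suff H : lower_span x `<=` [set v | lower_span y (v * fm z)].
  by have := H _ xl; rewrite /= -mmap1D yE.
apply: kspan_min.
  have [L0 LD] := kspan_lin_closed
    [set fm y' | y' in [set y' | wt y' = wt y /\ (y' < y)%O]].
  split=> [|c u v uL vL] /=; first by rewrite mul0r.
  by rewrite mulrDl -scalerAl; apply: LD.
move=> _ [x' [x'w x'x] <-] /=; apply: kspan_gen; exists (mnm_add x' z).
  split; first by rewrite wtD x'w -wtD yE.
  by rewrite -[X in (_ < X)%O]yE ltmc_add2l.
exact: mmap1D.
Qed.

(** Macaulay's basis theorem: non-standard monomials are rewritten by well-founded descent, and the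
    largest monomial of a nontrivial relation would not be standard. *)
Lemma has_dim_standard d (E : seq (multinom m)) : uniq E ->
  (forall x, x \in E <-> wt x = d) ->
  has_dim (std_grading G d) (count (fun x => `[< standard x >]) E).
Proof.
move=> Eu EP; rewrite -size_filter; set L := [seq x <- E | _].
pose b (i : 'I_(size L)) := fm (tnth (in_tuple L) i).
have LP x : x \in L <-> wt x = d /\ standard x.
  rewrite mem_filter; split=> [/andP[/asboolP xs /EP xd]|[/EP xd xs]] //.
  by apply/andP; split=> //; exact/asboolP.
have LtP i : wt (tnth (in_tuple L) i) = d /\ standard (tnth (in_tuple L) i).
  exact/LP/mem_tnth.
exists b; split.
- by move=> i; have := std_grading_mmap1 (tnth (in_tuple L) i); rewrite (LtP i).1.
- pose W : set (subalgebra G) := [set v | exists c : 'I_(size L) -> k, v = \sum_i c i *: b i].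
  have Wlin : lin_closed W.
    split=> [|c _ _ [l ->] [l' ->]].
      by exists (fun=> 0); rewrite big1 // => i _; rewrite scale0r.
    exists (fun i => c * l i + l' i); rewrite scaler_sumr -big_split /=.
    by apply: eq_bigr => i _; rewrite scalerDl scalerA.
  suff fmW x : wt x = d -> W (fm x).
    move=> v /std_grading_kspan vS; apply: (kspan_min Wlin _ vS) => _ [x xd <-].
    exact: fmW.
  elim/(well_founded_ind (@ltom_wf m)): x => x IH xd.
  have [xl|xstd] := pselect (lower_span x (fm x)).
    apply: (kspan_min Wlin _ xl) => _ [y [yw yx] <-].
    by apply: IH => //; rewrite yw.
  have /LP xL := conj xd xstd.
  have iL : (index x L < size L)%N by rewrite index_mem.
  exists (fun j => (j == Ordinal iL)%:R); rewrite (bigD1 (Ordinal iL)) //= eqxx.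
  rewrite scale1r big1 => [|j /negbTE ->]; last by rewrite scale0r.
  by rewrite addr0 /b (tnth_nth x) /= nth_index.
move=> c c0 i; apply/eqP/negPn/negP => ci.
pose S := [seq tnth (in_tuple L) j | j <- enum 'I_(size L) & c j != 0].
have [] := monomial_max (mnmc_monomial_order m) (s := S).
  have : tnth (in_tuple L) i \in S by apply: map_f; rewrite mem_filter ci mem_enum.
  by case: S.
move=> _ /mapP [j + ->]; rewrite mem_filter => /andP[cj _] jmax.
have [jd jstd] := LtP j; apply: jstd; rewrite -/(b j).
have -> : b j = \sum_(t | t != j) (- (c j)^-1 * c t) *: b t.
  move: c0; rewrite (bigD1 j) //= => /eqP; rewrite addr_eq0 => /eqP c0.
  apply: (scalerI cj); rewrite c0 scaler_sumr -sumrN; apply: eq_bigr => t _.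
  by rewrite scalerA mulrA mulrN divff // mulN1r scaleNr.
have LL := kspan_lin_closed [set fm y | y in
  [set y | wt y = wt (tnth (in_tuple L) j) /\ (y < tnth (in_tuple L) j)%O]].
rewrite (bigID (fun t => c t != 0)) /= [X in _ + X]big1 ?addr0.
  apply: lin_closed_sum => // t /andP[tj ct]; apply: kspan_gen.
  exists (tnth (in_tuple L) t) => //; split; first by rewrite jd (LtP t).1.
  apply: jmax; first by apply: map_f; rewrite mem_filter ct mem_enum.
  by rewrite !(tnth_nth mnm0) /= nth_uniq // filter_uniq.
by move=> t /andP[_ /negPn/eqP ->]; rewrite mulr0 scale0r.
Qed.

Definition seq_mnm (s : seq nat) : multinom m := Multinom [tuple nth 0%N s i | i < m].

Lemma vdim_std_grading_wcount d : vdim (std_grading G d) =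
  wcount [seq w i | i <- enum 'I_m] (fun s => `[< standard (seq_mnm s) >]) d.
Proof.
set ws := [seq w i | i <- enum 'I_m].
have ws0 : all (leq 1) ws by apply/allP => _ /mapP [i _ ->].
have sws : size ws = m by rewrite size_map size_enum_ord.
have wtE s : size s = m ->
    sumn [seq (p.1 * p.2)%N | p <- zip s ws] = wt (seq_mnm s).
  move=> ss; rewrite sumnE big_map /wt.
  rewrite (big_nth (0%N, 0%N)) size_zip ss sws minnn big_mkord.
  apply: eq_bigr => i _; rewrite nth_zip ?ss ?sws //= mnmE; congr (_ * _)%N.
  by rewrite (nth_map i) ?size_enum_ord // nth_ord_enum.
rewrite /wcount.
have -> : count (fun s => `[< standard (seq_mnm s) >]) (wexp ws d) =
    count (fun x => `[< standard x >]) [seq seq_mnm s | s <- wexp ws d].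
  by rewrite count_map.
apply/has_dim_vdim/has_dim_standard.
  rewrite map_inj_in_uniq ?uniq_wexp // => s t.
  rewrite !mem_wexp // => /andP[/eqP ss _] /andP[/eqP st _] /mnmP E.
  apply: (@eq_from_nth _ 0%N) => [|i]; first by rewrite ss st.
  by rewrite ss sws => im; have := E (Ordinal im); rewrite !mnmE.
move=> x; split=> [/mapP [s + ->]|xd].
  by rewrite mem_wexp // sws => /andP[/eqP ss /eqP <-]; rewrite wtE.
have xE : seq_mnm x = x by apply/mnmP => i; rewrite mnmE -mnm_nth.
apply/mapP; exists (multinom_val x : seq nat); last by rewrite xE.
by rewrite mem_wexp // size_tuple sws eqxx wtE ?size_tuple // xE xd /=.
Qed.

Lemma rational_std_grading (R : nzRingType) :
  exists2 ws, all (leq 1) ws &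
    rational_seq ws (fun d => (vdim (std_grading G d))%:R : R).
Proof.
exists [seq w i | i <- enum 'I_m]; first by apply/allP => _ /mapP [i _ ->].
rewrite (_ : (fun d => _) = (fun d => (wcount [seq w i | i <- enum 'I_m]
    (fun s => `[< standard (seq_mnm s) >]) d)%:R)); last first.
  by apply/funext => d; rewrite vdim_std_grading_wcount.
apply: rational_wcount; first by apply/allP => _ /mapP [i _ ->].
rewrite size_map size_enum_ord => s t ss st st_le /asboolP tstd.
apply/asboolP; apply: standard_down tstd => i; rewrite !mnmE.
move: st_le; rewrite all2E ss st eqxx /= => /(all_nthP (0%N, 0%N)) /(_ i).
by rewrite size_zip ss st minnn ltn_ord nth_zip ?ss ?st //; apply.
Qed.

End StandardMonomials.

Section FinitelyGenerated.
Variables (k : fieldType) (n m : nat) (f : 'I_m -> mpoly n k).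
Hypothesis hf : forall i, exists d, f i \is ishomog1 d mdeg.
Local Notation F := (range f).
Local Notation sval := (@subalgebra_val k n F).

(* A constant generator is replaced by 0, of weight 1: all weights are then
   positive and only finitely many monomials have a given weight. *)
Lemma ex_pos_weight_gens : exists (a : 'I_m -> subalgebra F) (w : 'I_m -> nat),
  [/\ forall i, (0 < w i)%N, forall i, std_grading F (w i) (a i)
    & forall b, kspan (range (mmap1 a)) b].
Proof.
have fF i : f i \in gen_subalg F by apply: gen_subalg_gen; exists i.
have /choice [aw awP] : forall i, exists aw : subalgebra F * nat,
    [/\ (0 < aw.2)%N, std_grading F aw.2 aw.1
      & sval aw.1 = f i \/ exists c, f i = mpolyC n c].
  move=> i; have [[|d] fd] := hf i.
    exists (0, 1%N); split=> //; first exact: rpred0.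
    right; exists (mcoeff mnm0 (f i)); apply/mpolyP => v; rewrite mcoeffC.
    have [->|v0] := eqVneq v mnm0; first by rewrite mulr1.
    rewrite mulr0 (dhomog_nemf_coeff fd) //.
    by have : mdeg v != 0%N by rewrite mdeg_eq0.
  by exists (Subalgebra (fF i), d.+1); split=> //; left.
pose a i := (aw i).1; exists a, (fun i => (aw i).2).
split=> [i|i|b]; [by case: (awP i)|by case: (awP i)|].
pose X : set (subalgebra F) := range (mmap1 a).
have Xlin := kspan_lin_closed X.
have X1 : kspan X 1 by apply: kspan_gen; exists mnm0 => //; rewrite mmap11.
have XM u v : kspan X u -> kspan X v -> kspan X (u * v).
  move=> uX vX.
  suff H : kspan X `<=` [set u | kspan X (u * v)] by exact: H.
  apply: kspan_min.
    split=> [|c x y xv yv] /=; first by rewrite mul0r; case: Xlin.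
    by rewrite mulrDl -scalerAl; apply: Xlin.2.
  move=> _ [x _ <-] /=.
  suff H : kspan X `<=` [set v | kspan X (mmap1 a x * v)] by exact: H.
  apply: kspan_min.
    split=> [|c y z yv zv] /=; first by rewrite mulr0; case: Xlin.
    by rewrite mulrDr -scalerAr; apply: Xlin.2.
  by move=> _ [y _ <-] /=; apply: kspan_gen; exists (mnm_add x y) => //; rewrite mmap1D.
(* [K] is an algebra containing every [f i]; a constant generator is a multiple of the empty
   monomial. *)
pose K := [pred p | `[< exists2 b : subalgebra F, sval b = p & kspan X b >]].
have /asboolP [b' /val_inj <- //] : sval b \in K.
apply: (@gen_subalg_min _ _ F K) (subalgebra_valP b); last first.
  move=> _ [i _ <-]; apply/asboolP; have [_ _ [fi|[c fc]]] := awP i.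
    exists (a i) => //; apply: kspan_gen; exists (mnm1 i) => //.
    exact: mmap1U.
  exists (c *: 1); last first.
    by rewrite -[_ *: _]addr0; apply: Xlin.2 => //; case: Xlin.
  by rewrite fc -alg_mpolyC.
split=> [|c u v /asboolP [x <- xX] /asboolP [y <- yX]|
          u v /asboolP [x <- xX] /asboolP [y <- yX]]; apply/asboolP.
- by exists 1.
- by exists (c *: x + y) => //; apply: Xlin.2.
- by exists (x * y) => //; exact: XM.
Qed.

Lemma rational_hilbert_fg (R : nzRingType) :
  exists2 ws, all (leq 1) ws &
    rational_seq ws (fun d => (vdim (std_grading F d))%:R : R).
Proof.
have [a [w [w0 aw agen]]] := ex_pos_weight_gens.
exact: rational_std_grading w0 aw agen R.
Qed.

End FinitelyGenerated.

(** * The order of the pole at 1 *)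

Section GeneratingSeries.
Variable R : realType.
Implicit Types (u : nat -> R) (t : R).

Definition gsum u t N : R := \sum_(i < N) u i * t ^+ i.

Lemma gsum_abel u t N :
  gsum u t N = (1 - t) * gsum (fun d => \sum_(i < d.+1) u i) t N
               + t ^+ N * \sum_(i < N) u i.
Proof.
rewrite /gsum; elim: N => [|N IH]; first by rewrite !big_ord0 !mulr0 addr0.
rewrite 2!big_ord_recr /= IH [\sum_(i < N.+1) u i]big_ord_recr /= exprS; ring.
Qed.

Lemma sum_bin_diag j d : (\sum_(i < d.+1) 'C(i + j, j) = 'C(d + j.+1, j.+1))%N.
Proof.
elim: d => [|d IH]; first by rewrite big_ord1 !add0n !binn.
by rewrite big_ord_recr /= IH [in RHS]addnS binS addSnnS.
Qed.

(** By [sum_bin_diag] the partial sums of binomials are the next binomials, so Abel summation gains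
    one factor 1 - t at each step. *)
Lemma gsum_bin_le j t N : 0 < t -> t < 1 ->
  gsum (fun i => 'C(i + j, j)%:R) t N <= ((1 - t) ^+ j.+1)^-1.
Proof.
move=> t0 t1; have t10 : 0 < 1 - t by rewrite subr_gt0.
elim: j N => [|j IH] N.
  rewrite expr1 -[X in _ <= X]mulr1 ler_pdivlMl //.
  have -> : gsum (fun i => 'C(i + 0, 0)%:R) t N = \sum_(i < N) t ^+ i.
    by apply: eq_bigr => i _; rewrite bin0 mul1r.
  by rewrite mulrC -opprB mulrN mulrC -subrX1 opprB gerBl exprn_ge0 // ltW.
rewrite exprS invfM ler_pdivlMl //.
apply: le_trans (IH N); rewrite [leRHS]gsum_abel.
rewrite (_ : gsum (fun d => \sum_(i < d.+1) _) t N =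
  gsum (fun i => 'C(i + j.+1, j.+1)%:R) t N); last first.
  by apply: eq_bigr => i _; rewrite -natr_sum sum_bin_diag.
by rewrite lerDl mulr_ge0 ?exprn_ge0 ?(ltW t0) // sumr_ge0.
Qed.

Lemma bin_expr_le j t N : 0 < t -> t < 1 ->
  'C(N + j, j)%:R * t ^+ N <= ((1 - t) ^+ j)^-1.
Proof.
move=> t0 t1; case: j => [|j].
  by rewrite bin0 mul1r expr0 invr1 exprn_ile1 // ltW.
apply: le_trans (gsum_bin_le j N.+1 t0 t1).
rewrite -sum_bin_diag natr_sum mulr_suml; apply: ler_sum => i _.
rewrite ler_wpM2l // ler_wiXn2l ?(ltW t0) ?(ltW t1) //.
by rewrite leq_ord.
Qed.

Lemma expn_le_bin D d : (d.+1 ^ D <= D`! * 'C(d + D, D))%N.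
Proof.
rewrite mulnC bin_ffact ffact_prod -[X in (_ ^ X <= _)%N]card_ord -prod_nat_const.
by apply: leq_prod => i _; have := ltn_ord i; lia.
Qed.

(** The main term and the boundary term of Abel summation are each at most D! / (1 - t)^D, whence
    the factor 2. *)
Lemma gsum_poly_growth_le (h : nat -> nat) D t N : 0 < t -> t < 1 ->
  (forall M, (\sum_(d < M.+1) h d <= M.+1 ^ D)%N) ->
  gsum (fun d => (h d)%:R) t N <= (D`!).*2%:R / (1 - t) ^+ D.
Proof.
move=> t0 t1 hD; have t10 : 0 < 1 - t by rewrite subr_gt0.
have bound M : \sum_(i < M.+1) ((h i)%:R : R) <= D`!%:R * 'C(M + D, D)%:R.
  by rewrite -natr_sum -natrM ler_nat (leq_trans (hD M)) // expn_le_bin.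
rewrite gsum_abel -addnn natrD [leRHS]mulrDl lerD //.
  apply: (@le_trans _ _ ((1 - t) * (D`!%:R * gsum (fun i => 'C(i + D, D)%:R) t N))).
    rewrite ler_wpM2l ?(ltW t10) // mulr_sumr; apply: ler_sum => i _.
    by rewrite mulrA ler_wpM2r ?exprn_ge0 ?(ltW t0).
  rewrite mulrCA ler_wpM2l // -ler_pdivlMl // -invfM -exprS.
  apply: le_trans (gsum_bin_le D N t0 t1) _.
  by rewrite exprS invfM.
apply: (@le_trans _ _ (t ^+ N * (D`!%:R * 'C(N + D, D)%:R))).
  rewrite ler_wpM2l ?exprn_ge0 ?(ltW t0) //; apply: le_trans (bound N).
  by rewrite big_ord_recr lerDl.
by rewrite mulrCA ler_wpM2l // mulrC bin_expr_le.
Qed.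

Lemma cvg_gsum_delta u t w s : gsum u t N @[N --> \oo] --> s ->
  gsum (delta w u) t N @[N --> \oo] --> (1 - t ^+ w) * s.
Proof.
move=> us; rewrite mulrBl mul1r.
have -> : gsum (delta w u) t = gsum u t \- gsum (shift w u) t.
  apply/funext => N; rewrite /gsum /= -sumrB; apply: eq_bigr => i _.
  by rewrite mulrBl.
apply: cvgB => //; rewrite -(cvg_shiftn w).
have -> : (fun N => gsum (shift w u) t (N + w)%N) = (fun N => t ^+ w * gsum u t N).
  apply/funext => N; rewrite /gsum mulr_sumr addnC big_split_ord /= big1 ?add0r.
    apply: eq_bigr => i _; rewrite /shift leq_addr addKn exprD.
    by rewrite mulrCA.
  by move=> i _; rewrite /shift leqNgt ltn_ord mul0r.
exact: cvgMl_tmp.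
Qed.

Lemma cvg_gsum_foldl_delta u t ws s : gsum u t N @[N --> \oo] --> s ->
  gsum (foldl (fun h w => delta w h) u ws) t N @[N --> \oo] -->
  (\prod_(w <- ws) (1 - t ^+ w)) * s.
Proof.
elim: ws u s => [|w ws IH] u s us; first by rewrite big_nil mul1r.
rewrite big_cons -mulrA mulrCA; apply: IH.
exact: cvg_gsum_delta.
Qed.

Lemma rational_seq_poly u ws : rational_seq ws u -> exists q : {poly R},
  forall t s, gsum u t N @[N --> \oo] --> s -> (\prod_(w <- ws) (1 - t ^+ w)) * s = q.[t].
Proof.
move=> [N0 uN]; set v := foldl _ u ws in uN.
exists (\poly_(i < N0) v i) => t s /(@cvg_gsum_foldl_delta _ _ ws) vs.
suff vq : gsum v t N @[N --> \oo] --> (\poly_(i < N0) v i).[t].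
  exact: (cvg_unique _ vs vq).
rewrite horner_poly -(cvg_shiftn N0).
apply: cvg_near_cst; apply: nearW => N.
rewrite /= /gsum addnC big_split_ord /= [X in _ + X]big1 ?addr0 // => i _.
by rewrite uN ?mul0r ?leq_addr.
Qed.

End GeneratingSeries.

Section PoleOrder.
Variables (R : realType) (h : nat -> nat) (D c : nat) (ws : seq nat).
Hypothesis h_le : forall N, (\sum_(d < N.+1) h d <= N.+1 ^ D)%N.
Hypotheses (c0 : (0 < c)%N)
  (h_ge : forall N, (N.+1 ^ D <= \sum_(d < (c * N).+1) h d)%N).
Hypothesis ws0 : all (leq 1) ws.
Let hR d : R := (h d)%:R.
Hypothesis hrat : rational_seq ws hR.

Definition gseries (t : R) : R := limn (gsum hR t).

Lemma cvg_gseries t : 0 < t -> t < 1 -> gsum hR t N @[N --> \oo] --> gseries t.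
Proof.
move=> t0 t1; apply: nondecreasing_is_cvgn.
  apply/nondecreasing_seqP => N; rewrite /gsum big_ord_recr lerDl.
  by rewrite mulr_ge0 ?exprn_ge0 ?(ltW t0).
by exists ((D`!).*2%:R / (1 - t) ^+ D) => _ [N _ <-]; exact: gsum_poly_growth_le.
Qed.

Lemma gseries_le t : 0 < t -> t < 1 -> gseries t <= (D`!).*2%:R / (1 - t) ^+ D.
Proof.
move=> t0 t1; apply: (cvgr_to_le (cvg_gseries t0 t1)).
by apply: nearW => N; exact: gsum_poly_growth_le.
Qed.

Lemma gsum_le_gseries t N : 0 < t -> t < 1 -> gsum hR t N <= gseries t.
Proof.
move=> t0 t1; apply: nondecreasing_cvgn_le; last exact: cvg_gseries.
apply/nondecreasing_seqP => M; rewrite /gsum big_ord_recr lerDl.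
by rewrite mulr_ge0 ?exprn_ge0 ?(ltW t0).
Qed.

Lemma gseries_ge1 t : 0 < t -> t < 1 -> 1 <= gseries t.
Proof.
move=> t0 t1; apply: le_trans (gsum_le_gseries 1 t0 t1).
rewrite /gsum big_ord1 expr0 mulr1 ler1n.
by have := h_ge 0; rewrite exp1n muln0 big_ord1.
Qed.

Lemma near_left1 : \forall t \near (1 : R)^'-, 0 < t /\ t < 1.
Proof.
near=> t; split; near: t; [exact: nbhs_left_gt | exact: nbhs_left_lt].
Unshelve. all: by end_near.
Qed.

Lemma cvg_horner_left1 (p : {poly R}) : p.[t] @[t --> (1 : R)^'-] --> p.[1].
Proof. by apply: cvg_at_left_filter; exact: continuous_horner. Qed.

Lemma bernoulli_1B (x : R) N : 0 <= x -> x <= 1 -> 1 - N%:R * x <= (1 - x) ^+ N.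
Proof.
move=> x0 x1; elim: N => [|N IH]; first by rewrite mul0r subr0 expr0.
rewrite exprS; apply: le_trans (ler_wpM2l _ IH); last by rewrite subr_ge0.
have xx : 0 <= N%:R * (x * x) by rewrite !mulr_ge0.
rewrite -natr1; nra.
Qed.

(* The series is large at [t = 1 - 1 / (2 c (N + 1))], since the terms of degree
   at most [c (N + 1)] have [t ^ i >= 1 / 2]. *)
Lemma not_cvg_gseries d (l : R) : (d < D)%N ->
  ~ (1 - t) ^+ d * gseries t @[t --> (1 : R)^'-] --> l.
Proof.
move=> dD /cvg_at_leftP fl.
pose y N : R := ((2 * c)%N%:R)^-1 * (N.+1%:R)^-1.
have c2 : 0 < (2 * c)%N%:R :> R by rewrite ltr0n muln_gt0.
have y0 N : 0 < y N by apply: mulr_gt0; rewrite invr_gt0 // ltr0n.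
have y1 N : y N < 1.
  rewrite /y -invfM -natrM invf_lt1 ?ltr0n ?ltr1n ?muln_gt0 ?c0 //.
  by rewrite -mulnA mul2n -addnn -[1%N]addn0 -addnS leq_add // muln_gt0 c0.
have uP : (forall N, 1 - y N < 1) /\ (1 - y N) @[N --> \oo] --> (1 : R).
  split=> [N|]; first by rewrite gtrBl.
  rewrite -[X in _ --> X]subr0; apply: cvgB; first exact: cvg_cst.
  rewrite -(mulr0 ((2 * c)%N%:R : R)^-1); apply: cvgMl_tmp.
  exact: cvg_harmonic.
have ll : l < l + 1 by rewrite ltrDl.
have /cvgr_lt/(_ _ ll) lt_l := fl _ uP.
(* At the point 1 - y N the function is at least (N + 1) / K, which is unbounded. *)
pose K : R := ((2 * c) ^ d * 2)%N%:R.
have K0 : 0 < K by rewrite ltr0n muln_gt0 expn_gt0 muln_gt0 c0.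
have := @cvgr_idn R; rewrite cvgryPge => /(_ (K * (l + 1))) le_N.
have [N [/= N1 N2]] := filter_ex (filterI lt_l le_N).
suff : N%:R < K * (l + 1) by rewrite ltNge N2.
apply: lt_le_trans (_ : N.+1%:R <= _); first by rewrite ltr_nat.
rewrite mulrC -ler_pdivrMr //; apply: le_trans (ltW N1).
set M := (c * N.+1)%N; have M0 : (0 < M)%N by rewrite muln_gt0 c0.
have yE : y N = ((2 * M)%N%:R)^-1 by rewrite /y -invfM -natrM -mulnA.
have u0 : 0 < 1 - y N by rewrite subr_gt0.
have u1 : 1 - y N < 1 by rewrite gtrBl.
apply: (@le_trans _ _ (y N ^+ d * (2^-1 * (N.+1 ^ D)%N%:R))).
  have -> : y N ^+ d = ((2 * c) ^ d)%N%:R^-1 / (N.+1%:R ^+ d).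
    by rewrite /y exprMn !exprVn natrX.
  have -> : (N.+1 ^ D)%N%:R = N.+1%:R ^+ (D - d.+1) * N.+1%:R ^+ d * N.+1%:R :> R.
    by rewrite natrX -exprD -exprSr -addnS subnK.
  rewrite /K natrM invfM.
  have N0 : (N.+1%:R : R) ^+ d != 0 by rewrite expf_neq0 // pnatr_eq0.
  set A := ((2 * c) ^ d)%N%:R^-1 : R; set B := (N.+1%:R : R) ^+ (D - d.+1).
  have B1 : 1 <= B by rewrite exprn_ege1 // ler1n.
  have -> : A / N.+1%:R ^+ d * (2^-1 * (B * N.+1%:R ^+ d * N.+1%:R)) =
    B * (N.+1%:R * (A * 2^-1)) by field.
  by rewrite -[leLHS]mul1r ler_wpM2r // !mulr_ge0 // ?invr_ge0.
rewrite opprB addrC subrK ler_wpM2l ?exprn_ge0 ?(ltW (y0 N)) //.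
apply: le_trans (gsum_le_gseries M.+1 u0 u1).
apply: (@le_trans _ _ ((1 - y N) ^+ M * (\sum_(i < M.+1) h i)%N%:R)).
  apply: ler_pM => //.
    apply: le_trans (bernoulli_1B M (ltW (y0 N)) (ltW (y1 N))).
    rewrite yE natrM invfM mulrCA divff ?pnatr_eq0 ?gtn_eqF // mulr1.
    lra.
  rewrite ler_nat /M; apply: leq_trans (h_ge N.+1).
  by rewrite leq_exp2r // (leq_trans _ dD).
rewrite natr_sum mulr_sumr; apply: ler_sum => i _.
by rewrite mulrC ler_wpM2l // ler_wiXn2l ?(ltW u0) ?(ltW u1) // leq_ord.
Qed.

(** Writing [a] for the order of the numerator at 1 and r for [size ws], the series is (1 - t)^(a -
    r) times a function with a finite nonzero limit; it remains to show r <= D + a. *)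
Lemma cvg_gseries_rank : exists l : R,
  (1 - t) ^+ D * gseries t @[t --> (1 : R)^'-] --> l.
Proof.
have [q qP] := rational_seq_poly hrat.
pose E : {poly R} := \prod_(w <- ws) \sum_(i < w) 'X^i.
have Et t : E.[t] = \prod_(w <- ws) \sum_(i < w) t ^+ i.
  rewrite /E horner_prod; apply: eq_bigr => w _.
  by rewrite horner_sum; apply: eq_bigr => i _; rewrite hornerXn.
have Epos t : 0 < t -> 0 < E.[t].
  move=> t0; rewrite Et; elim: (ws) ws0 => [|w s IH] /=; first by rewrite big_nil.
  move=> /andP[w0 /IH s0]; rewrite big_cons mulr_gt0 //.
  case: w w0 => // w _; rewrite big_ord_recl expr0 ltr_wpDr // sumr_ge0 // => i _.
  by rewrite exprn_ge0 // ltW.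
have prodE t : \prod_(w <- ws) (1 - t ^+ w) = (1 - t) ^+ size ws * E.[t].
  rewrite Et; elim: (ws) => [|w s IH]; first by rewrite !big_nil mulr1.
  rewrite !big_cons IH /= exprS -opprB subrX1 -mulNr opprB; ring.
have [a [q1 q1P qE]] := multiplicity_XsubC q 1.
(* The numerator is not zero, as the series is at least 1 at t = 1/2. *)
have q1_1 : q1.[1] != 0.
  move: q1P; rewrite rootE; case: eqP => //= q0 _.
  have h01 : 0 < 2^-1 :> R by rewrite invr_gt0.
  have h11 : 2^-1 < 1 :> R by rewrite invf_lt1 // ltr1n.
  have Pg := lt_le_trans ltr01 (gseries_ge1 h01 h11).
  have pos : 0 < (1 - 2^-1) ^+ size ws * E.[2^-1] * gseries 2^-1.
    by rewrite !mulr_gt0 ?Epos ?exprn_gt0 ?subr_gt0.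
  have := qP _ _ (cvg_gseries h01 h11).
  by rewrite q0 horner0 prodE => qh; rewrite qh ltxx in pos.
pose g (t : R) : R := q1.[t] / E.[t] * (-1) ^+ a.
have gE t : 0 < t -> t < 1 ->
    (1 - t) ^+ size ws * gseries t = g t * (1 - t) ^+ a.
  move=> t0 t1; have := qP _ _ (cvg_gseries t0 t1).
  rewrite prodE qE hornerM horner_exp hornerXsubC => H.
  have Et0 : E.[t] != 0 by rewrite gt_eqF ?Epos.
  have sgn : (t - 1) ^+ a = (-1) ^+ a * (1 - t) ^+ a.
    by rewrite -exprMn mulN1r opprB.
  by apply: (mulIf Et0); rewrite mulrAC H sgn /g; field.
pose g1 := q1.[1] / E.[1] * (-1) ^+ a.
have g1_0 : g1 != 0.
  by rewrite !mulf_neq0 ?invr_eq0 ?expf_neq0 ?oppr_eq0 ?oner_eq0 // gt_eqF ?Epos.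
have gcvg : g t @[t --> (1 : R)^'-] --> g1.
  apply: cvgMr_tmp; apply: cvgM; first exact: cvg_horner_left1.
  by apply: cvgV; [rewrite gt_eqF ?Epos | exact: cvg_horner_left1].
(* Otherwise the growth bound would give g t <= K (1 - t), forcing the limit [g1], which is
   nonnegative and nonzero, to be at most 0. *)
have le_sDa : (size ws <= D + a)%N.
  rewrite leqNgt; apply/negP => Das.
  pose K : R := (D`!).*2%:R.
  have gK : \forall t \near (1 : R)^'-, g t - K * (1 - t) <= 0.
    apply: filterS near_left1 => t [t0 t1]; rewrite subr_le0.
    have t10 : 0 < 1 - t by rewrite subr_gt0.
    have gD : (1 - t) ^+ D * gseries t <= K.
      by rewrite mulrC -ler_pdivlMr ?exprn_gt0 // gseries_le.
    have e1 : (1 - t) ^+ (size ws - (D + a).+1) <= 1.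
      by rewrite exprn_ile1 ?(ltW t10) // gerBl ltW.
    have P0 : 0 <= gseries t by apply: le_trans (gseries_ge1 t0 t1).
    rewrite -(ler_pM2r (exprn_gt0 a t10)) -gE // -(subnK Das) exprD.
    have -> : (1 - t) ^+ (D + a).+1 = (1 - t) * (1 - t) ^+ a * (1 - t) ^+ D.
      by rewrite exprS exprD mulrAC mulrA.
    rewrite -!mulrA; apply: le_trans (ler_piMl _ e1) _.
      by rewrite !mulr_ge0 ?exprn_ge0 ?(ltW t10).
    by rewrite mulrA [leRHS]mulrC ler_wpM2l // mulr_ge0 ?exprn_ge0 ?(ltW t10).
  have g1_le : g1 <= 0.
    have lin : K * (1 - t) @[t --> (1 : R)^'-] --> K * (1 - 1).
      apply: cvgMl_tmp; apply: cvgB; first exact: cvg_cst.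
      exact: cvg_at_left_filter cvg_id.
    have le0 : g1 - K * (1 - 1) <= 0 by exact: (cvgr_to_le (cvgB gcvg lin) gK).
    by move: le0; rewrite subrr mulr0 subr0.
  have g1_ge : 0 <= g1.
    apply: (cvgr_to_ge gcvg); apply: filterS near_left1 => t [t0 t1].
    have t10 : 0 < 1 - t by rewrite subr_gt0.
    rewrite -(pmulr_lge0 _ (exprn_gt0 a t10)) -gE //.
    rewrite mulr_ge0 ?exprn_ge0 ?(ltW t10) //.
    exact: le_trans (gseries_ge1 t0 t1).
  by move/eqP: g1_0; apply; apply/eqP; rewrite eq_le g1_le.
exists (g1 * ((1 - 'X) ^+ (D + a - size ws)).[1]).
apply: cvg_trans (cvgM gcvg (@cvg_horner_left1 ((1 - 'X) ^+ (D + a - size ws)))).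
apply: near_eq_cvg; apply: filterS near_left1 => t [t0 t1].
have t10 : 0 < 1 - t by rewrite subr_gt0.
have nz : (1 - t) ^+ size ws != 0 by rewrite gt_eqF ?exprn_gt0.
apply: (mulIf nz); rewrite /= horner_exp hornerD hornerN hornerX hornerC.
rewrite -[X in X = _]mulrA -exprD subnK // [RHS]mulrC mulrCA gE //.
by rewrite exprD; ring.
Qed.

End PoleOrder.

Section PoincareDimension.
Variables (R : realType) (k : fieldType) (V : lmodType k) (gr : nat -> set V).
Variables (D c : nat) (ws : seq nat).
Let h d := vdim (gr d).
Hypothesis h_le : forall N, (\sum_(d < N.+1) h d <= N.+1 ^ D)%N.
Hypotheses (c0 : (0 < c)%N)
  (h_ge : forall N, (N.+1 ^ D <= \sum_(d < (c * N).+1) h d)%N).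
Hypothesis ws0 : all (leq 1) ws.
Hypothesis hrat : rational_seq ws (fun d => (h d)%:R : R).

Lemma poincare_seriesE (t : R) : 0 < t -> t < 1 ->
  poincare_series gr t = (gseries h t)%:E.
Proof.
move=> t0 t1; rewrite /poincare_series /gseries.
have cv := cvg_gseries h_le t0 t1.
have : (fun N => (gsum (fun d => (h d)%:R) t N)%:E) @ \oo --> (gseries h t)%:E.
  by apply: cvg_EFin; [exact: nearW | exact: cv].
move=> /cvg_lim <- //; congr (limn _).
by apply/funext => N; rewrite /gsum -sumEFin big_mkord.
Qed.

Lemma poincare_dim_rank : poincare_dim R gr = D%:R%:E.
Proof.
(* On ]0, 1[ the series is finite, so limits in the extended reals are real limits. *)
have cvE d l : ((((1 - t) ^+ d)%:E * poincare_series gr t)%E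
      @[t --> (1 : R)^'-] --> l%:E) <->
    ((1 - t) ^+ d * gseries h t @[t --> (1 : R)^'-] --> l).
  have eqF : \forall t \near (1 : R)^'-,
      (((1 - t) ^+ d)%:E * poincare_series gr t)%E =
      ((1 - t) ^+ d * gseries h t)%:E.
    by apply: filterS (near_left1 R) => t [t0 t1]; rewrite poincare_seriesE.
  split=> cv.
    have : ((1 - t) ^+ d * gseries h t)%:E @[t --> (1 : R)^'-] --> l%:E.
      by apply: cvg_trans cv; exact: near_eq_cvg.
    by move=> /fine_cvgP[].
  have cv' : ((1 - t) ^+ d * gseries h t)%:E @[t --> (1 : R)^'-] --> l%:E.
    by apply: cvg_EFin => //; exact: nearW.
  apply: cvg_trans cv'; apply: near_eq_cvg.
  by apply: filterS eqF => t ->.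
apply/eqP; rewrite eq_le; apply/andP; split.
  apply: ereal_inf_lbound; exists D => //.
  have [l lP] := cvg_gseries_rank h_le h_ge ws0 hrat.
  by exists l; apply/cvE.
apply: le_ereal_inf_tmp => _ [d [l /cvE dl] <-].
rewrite lee_fin ler_nat leqNgt; apply/negP => dD.
exact: (not_cvg_gseries h_le c0 h_ge dD dl).
Qed.

End PoincareDimension.

(** * All dimensions equal the rank *)

Section GradedSubalgebraRank.
Variables (R : realType) (k : fieldType) (n : nat) (G : set (mpoly n k)).
Hypothesis Ghom : forall g, G g -> exists d, g \is ishomog1 d mdeg.
Variables (D : nat) (u : 'I_D -> multinom n).
Let hlt := mnmc_monomial_order n.
Hypothesis ubasis :
  mnm_basis (initial_exponents (fun a b => (a < b)%O) (gen_subalg G)) u.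

Lemma dims_eq_rank :
  [/\ gr_krull_dim R (std_grading G) = D%:R%:E,
      krull_dim R (subalgebra G) = D%:R%:E,
      trdeg R (subalgebra_scalar G) = D%:R%:E
    & GKdim R (subalgebra G) = D%:R%:E].
Proof.
have le1 := gr_krull_dim_le R (std_grading G).
have le2 := krull_dim_le_trdeg R (subalgebra_scalar G).
have le3 := trdeg_le_rank R hlt ubasis.
have ge := gr_krull_dim_ge_rank R Ghom ubasis.
have le4 := GKdim_le_rank R hlt ubasis.
have ge4 := GKdim_ge_rank R Ghom hlt ubasis.
split; apply: le_anti; apply/andP; split=> //.
- exact: le_trans (le_trans le1 le2) le3.
- exact: le_trans le2 le3.
- exact: le_trans ge le1.
- exact: le_trans (le_trans ge le1) le2.
Qed.

Lemma vdim_std_grading (lt : rel (multinom n)) : monomial_order lt -> forall d,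
  vdim (std_grading G d) = hilb (initial_exponents lt (gen_subalg G)) d.
Proof. by move=> ? d; exact: has_dim_vdim (has_dim_std_grading _ _ d). Qed.

Lemma poincare_dim_eq_rank ws : all (leq 1) ws ->
  rational_seq ws (fun d => (vdim (std_grading G d))%:R : R) ->
  poincare_dim R (std_grading G) = D%:R%:E.
Proof.
move=> ws0 rat.
have [c c0 cP] := sum_hilb_ge (initial_exponents0 _ _)
  (initial_exponentsD hlt) ubasis.
apply: (poincare_dim_rank _ c0 _ ws0 rat) => N.
  under eq_bigr do rewrite (vdim_std_grading hlt).
  by rewrite sum_hilb; exact: (card_mnm_basis N ubasis).
by under eq_bigr do rewrite (vdim_std_grading hlt); exact: cP.
Qed.

End GradedSubalgebraRank.

Theorem corollary1p4 (R : realType) (k : fieldType) (n m : nat)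
    (f : 'I_m -> mpoly n k) (hf : forall i, exists d, f i \is ishomog1 d mdeg)
    (lt : rel (multinom n)) (hlt : monomial_order lt) :
  let F := range f in
  let I := initial_monomials lt (gen_subalg F) in
  gr_krull_dim R (std_grading F) = krull_dim R (subalgebra F) /\
  krull_dim R (subalgebra F) = trdeg R (subalgebra_scalar F) /\
  trdeg R (subalgebra_scalar F) = GKdim R (subalgebra F) /\
  GKdim R (subalgebra F) = poincare_dim R (std_grading F) /\
  poincare_dim R (std_grading F) = gr_krull_dim R (std_grading I) /\
  gr_krull_dim R (std_grading I) = krull_dim R (subalgebra I) /\
  krull_dim R (subalgebra I) = trdeg R (subalgebra_scalar I) /\
  trdeg R (subalgebra_scalar I) = GKdim R (subalgebra I) /\
  GKdim R (subalgebra I) = poincare_dim R (std_grading I).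
Proof.
move=> F I.
have Fhom g : F g -> exists d, g \is ishomog1 d mdeg by move=> [i _ <-].
have Ihom g : I g -> exists d, g \is ishomog1 d mdeg.
  exact: initial_monomials_homog.
have vdimE d : vdim (std_grading I d) = vdim (std_grading F d).
  rewrite !(vdim_std_grading _ hlt) //.
  by rewrite (initial_exponents_initial_algebra hlt).
have [ws ws0 ratF] := rational_hilbert_fg hf R.
(* Rationality passes from S to its initial algebra through the Hilbert function. *)
have ratI : rational_seq ws (fun d => (vdim (std_grading I d))%:R : R).
  by have -> : (fun d => (vdim (std_grading I d))%:R : R) =
    (fun d => (vdim (std_grading F d))%:R) by apply/funext => d; rewrite vdimE.
have poincareE : poincare_dim R (std_grading I) = poincare_dim R (std_grading F).
  have seriesE : poincare_series (std_grading I) =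
      poincare_series (std_grading F) :> (R -> \bar R).
    by apply/funext => t; apply: eq_eseriesr => i _; rewrite vdimE.
  by rewrite /poincare_dim seriesE.
have [D [u ubasis]] :=
  ex_mnm_basis (initial_exponents (fun a b => (a < b)%O) (gen_subalg F)).
have [E [v vbasis]] :=
  ex_mnm_basis (initial_exponents (fun a b => (a < b)%O) (gen_subalg I)).
have [-> -> -> ->] := dims_eq_rank R Fhom ubasis.
have [-> -> -> ->] := dims_eq_rank R Ihom vbasis.
have dF := poincare_dim_eq_rank Fhom ubasis ws0 ratF.
have dI := poincare_dim_eq_rank Ihom vbasis ws0 ratI.
(* The ranks [D] and [E] belong to the fixed order, for which the two sets of initial exponents may
   differ; the common Poincare series identifies them. *)
have DE : D%:R%:E = E%:R%:E :> \bar R by rewrite -dF -dI poincareE.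
rewrite dF dI DE; do !split.
Qed.
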